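(* Let $\mathbb{R}^n=\mathbb{R}^{2d}$ carry its canonical symplectic form and Poisson bracket. Let $A,B\in\operatorname{Sym}(n,\mathbb{R})$ be linearly independent, form a non-dissipative pair, and satisfy $\operatorname{maxrank}\{A,B\}\ge7$. Let $C\in\operatorname{Sym}(n,\mathbb{R})$ be given by $Q_C=\{Q_A,Q_B\}$, and assume $Q_C$ vanishes on $\{Q_A=0\}\cap\{Q_B=0\}$. Assume further that $\ker A\cap\ker B$ is either $\{0\}$ or a symplectic subspace of $\mathbb{R}^n$, and that no connected component of $\mathcal{N}$ spans $\mathbb{R}^n$. Then $C$ is a linear combination of $A$ and $B$.
   Context: $Q_M(z)={}^tzMz$. Canonical Poisson bracket on $\mathbb{R}^{2d}$ with coordinates $(x,\xi)$: $\{a,b\}=\sum_j(\partial_{\xi_j}a\,\partial_{x_j}b-\partial_{x_j}a\,\partial_{\xi_j}b)$. Non-dissipative pair: $0$ is the only positive semidefinite element of $\operatorname{span}_{\mathbb{R}}\{A,B\}$; $\operatorname{maxrank}\{A,B\}$ is the maximal rank of elements of this span. $\mathcal{N}:=\{z\in\mathbb{R}^n:Q_A(z)=Q_B(z)=0,\ Az\text{ and }Bz\text{ linearly independent}\}$, an analytic submanifold of codimension 2; a connected component spans $\mathbb{R}^n$ if its linear span is $\mathbb{R}^n$. *)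

(* Defs.v *)
(* Points of R^n = R^{2d} are row vectors
   'rV[R]_(d + d); the first d coordinates are x, the last d are xi. *)
From HB Require Import structures.
From mathcomp Require Import all_boot all_order all_algebra.
From mathcomp Require Import all_classical all_reals all_analysis.
Set Implicit Arguments. Unset Strict Implicit. Unset Printing Implicit Defensive.
Import Order.TTheory GRing.Theory Num.Theory.
Import numFieldNormedType.Exports.
Local Open Scope classical_set_scope.
Local Open Scope ring_scope.

Section Defs.
Variables (R : realType) (d : nat).
Notation n := (d + d)%N.

Definition Qf (M : 'M[R]_n) (z : 'rV[R]_n) : R := (z *m M *m z^T) ord0 ord0.

Definition xidx (j : 'I_d) : 'I_n := lshift d j.
Definition xiidx (j : 'I_d) : 'I_n := rshift d j.
Definition ebasis (i : 'I_n) : 'rV[R]_n := delta_mx ord0 i.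

Definition pd (f : 'rV[R]_n -> R) (i : 'I_n) (z : 'rV[R]_n) : R :=
  'D_(ebasis i) f z.

Definition poisson (a b : 'rV[R]_n -> R) (z : 'rV[R]_n) : R :=
  \sum_(j < d) (pd a (xiidx j) z * pd b (xidx j) z
                - pd a (xidx j) z * pd b (xiidx j) z).

Definition sympl (z w : 'rV[R]_n) : R :=
  \sum_(j < d) (z ord0 (xiidx j) * w ord0 (xidx j)
                - z ord0 (xidx j) * w ord0 (xiidx j)).

Definition symmetric_mx (M : 'M[R]_n) : Prop := M^T = M.

Definition lin_indep2 (A B : 'M[R]_n) : Prop :=
  forall a b : R, a *: A + b *: B = 0 -> a = 0 /\ b = 0.

Definition psd (M : 'M[R]_n) : Prop := forall z, 0 <= Qf M z.

Definition non_dissipative (A B : 'M[R]_n) : Prop :=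
  forall a b : R, psd (a *: A + b *: B) -> a *: A + b *: B = 0.

Definition maxrank_ge (A B : 'M[R]_n) (k : nat) : Prop :=
  exists a b : R, (k <= \rank (a *: A + b *: B))%N.

(* ker A cap ker B (A, B symmetric, so row and column kernels agree) *)
Definition common_ker (A B : 'M[R]_n) : set 'rV[R]_n :=
  [set z | z *m A = 0 /\ z *m B = 0].

Definition is_zero_subspace (S : set 'rV[R]_n) : Prop := S = [set 0].

Definition symplectic_subspace (S : set 'rV[R]_n) : Prop :=
  S 0 /\ (forall (a : R) u v, S u -> S v -> S (a *: u + v)) /\
  (forall u, S u -> (forall v, S v -> sympl u v = 0) -> u = 0).

Definition vec_indep2 (u v : 'rV[R]_n) : Prop :=
  forall a b : R, a *: u + b *: v = 0 -> a = 0 /\ b = 0.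

Definition Nset (A B : 'M[R]_n) : set 'rV[R]_n :=
  [set z | Qf A z = 0 /\ Qf B z = 0 /\ vec_indep2 (z *m A) (z *m B)].

Definition spans_all (S : set 'rV[R]_n) : Prop :=
  forall v : 'rV[R]_n, exists (k : nat) (c : 'I_k -> R) (p : 'I_k -> 'rV[R]_n),
    (forall i, S (p i)) /\ v = \sum_(i < k) c i *: p i.

End Defs.

(* Main.v *)
(* Let A, B be the pencil.  Call a common zero x of Q_A, Q_B regular if Ax, Bx are
   independent.

   1. Unless A vanishes on a hyperplane, a regular zero exists: by the S-lemma there
   are A-isotropic z, w with Q_B(z) > 0 > Q_B(w), and along a conic
   y(t) = z + t v + t^2 w' on {Q_A = 0} the quartic Q_B(y(t)) has a root of each
   sign, which cannot both be double.

   2. Near a regular zero x, regular zeros are parametrised by curves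
   x + s u + s^2 r(s) through all tangent directions u.  If they all lie in a
   hyperplane ker h, then expanding in s shows that the element M of the pencil with
   Mx proportional to h vanishes on ker h, so Q_M = 2 h m for some linear form m.
   Here, as in step 3, the rank hypothesis enters through the fact that A and B do not
   both vanish on a subspace of codimension 2.

   3. Let Q_A = 2 l m after a change of basis.  If B is indefinite on ker l, then Q_C,
   vanishing on {l = Q_B = 0}, is a multiple of Q_B on ker l, hence 0 there because
   {l m, Q_B} restricts to a product of two linear forms.  This makes l an
   eigenvector: {l, Q_B} = c l.  If B were semidefinite on ker m, the Hamiltonian
   vector of l would either lie in ker A /\ ker B or produce a semidefinite element
   of the pencil.  So B is indefinite on ker m too, {m, Q_B} = c' m, and
   Q_C = (c + c') Q_A up to scaling. *)
Require Import Defs.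
From HB Require Import structures.
From mathcomp Require Import all_boot all_order all_algebra.
From mathcomp Require Import all_classical all_reals all_analysis.
From mathcomp Require Import ring lra zify.
Import Order.TTheory GRing.Theory Num.Theory.
Import numFieldNormedType.Exports.
Local Open Scope classical_set_scope.
Local Open Scope ring_scope.

(** * Bilinear forms on row vectors, and the rank of a pair vanishing on a subspace *)

Section BilinearForms.
Set Implicit Arguments. Unset Strict Implicit. Unset Printing Implicit Defensive.
Context {R : realType} {n : nat}.
Implicit Types (M A B : 'M[R]_n) (u v w z : 'rV[R]_n) (a b t : R).

Definition dot u v : R := (u *m v^T) ord0 ord0.
Definition bf M u v : R := dot (u *m M) v.

Lemma dotE u v : dot u v = \sum_i u ord0 i * v ord0 i.
Proof. by rewrite /dot mxE; apply: eq_bigr => i _; rewrite mxE. Qed.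
Lemma dotC u v : dot u v = dot v u.
Proof. by rewrite !dotE; apply: eq_bigr => i _; rewrite mulrC. Qed.
Lemma dotDl u v w : dot (u + v) w = dot u w + dot v w.
Proof. by rewrite /dot mulmxDl mxE. Qed.
Lemma dotZl a u v : dot (a *: u) v = a * dot u v.
Proof. by rewrite /dot -scalemxAl mxE. Qed.
Lemma dotDr u v w : dot w (u + v) = dot w u + dot w v.
Proof. by rewrite dotC dotDl !(dotC _ w). Qed.
Lemma dotZr a u v : dot v (a *: u) = a * dot v u.
Proof. by rewrite dotC dotZl dotC. Qed.
Lemma dotNl u v : dot (- u) v = - dot u v.
Proof. by rewrite -scaleN1r dotZl mulN1r. Qed.
Lemma dotNr u v : dot v (- u) = - dot v u.
Proof. by rewrite -scaleN1r dotZr mulN1r. Qed.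
Lemma dot0l v : dot 0 v = 0.
Proof. by rewrite /dot mul0mx mxE. Qed.
Lemma dot0r v : dot v 0 = 0.
Proof. by rewrite dotC dot0l. Qed.
Lemma dot_eq0 u : dot u u = 0 -> u = 0.
Proof.
rewrite dotE => /eqP; rewrite psumr_eq0 => [/allP u0|i _]; last first.
  by rewrite -expr2 sqr_ge0.
apply/rowP => i; rewrite mxE; apply/eqP.
by have := u0 i (mem_index_enum i); rewrite /= mulf_eq0 orbb.
Qed.
Lemma dot_ext u v : (forall w, dot w u = dot w v) -> u = v.
Proof.
move=> uv; apply/eqP; rewrite -subr_eq0; apply/eqP/dot_eq0.
by rewrite dotDr dotNr uv subrr.
Qed.

Lemma bfDl M u v w : bf M (u + v) w = bf M u w + bf M v w.
Proof. by rewrite /bf mulmxDl dotDl. Qed.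
Lemma bfZl M a u v : bf M (a *: u) v = a * bf M u v.
Proof. by rewrite /bf -scalemxAl dotZl. Qed.
Lemma bfDr M u v w : bf M w (u + v) = bf M w u + bf M w v.
Proof. exact: dotDr. Qed.
Lemma bfZr M a u v : bf M v (a *: u) = a * bf M v u.
Proof. exact: dotZr. Qed.
Lemma bfNl M u v : bf M (- u) v = - bf M u v.
Proof. by rewrite -scaleN1r bfZl mulN1r. Qed.
Lemma bfNr M u v : bf M v (- u) = - bf M v u.
Proof. exact: dotNr. Qed.
Lemma bfDm M N u v : bf (M + N) u v = bf M u v + bf N u v.
Proof. by rewrite /bf mulmxDr dotDl. Qed.
Lemma bfZm M a u v : bf (a *: M) u v = a * bf M u v.
Proof. by rewrite /bf -scalemxAr dotZl. Qed.
Lemma bfNm M u v : bf (- M) u v = - bf M u v.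
Proof. by rewrite -scaleN1r bfZm mulN1r. Qed.
Lemma bfC M u v : M^T = M -> bf M u v = bf M v u.
Proof.
by move=> sM; rewrite /bf dotC /dot trmx_mul sM mulmxA.
Qed.

Definition bfE := (bfDl, bfDr, bfNl, bfNr, bfZl, bfZr, bfDm, bfNm, bfZm).

Lemma bf_ext M N : (forall u v, bf M u v = bf N u v) -> M = N.
Proof.
move=> MN; apply/row_matrixP => i; rewrite !rowE.
by apply: dot_ext => w; rewrite dotC [RHS]dotC; exact: MN.
Qed.

Lemma bf_polar M u v : M^T = M ->
  bf M u v = (bf M (u + v) (u + v) - bf M u u - bf M v v) / 2.
Proof. by move=> sM; rewrite !bfE (bfC v u sM); field. Qed.

Lemma bf_ext_sym M N : M^T = M -> N^T = N ->
  (forall z, bf M z z = bf N z z) -> M = N.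
Proof.
by move=> sM sN MN; apply: bf_ext => u v;
  rewrite (bf_polar u v sM) (bf_polar u v sN) !MN.
Qed.

(** [f] is [dot v v] times the component of [u] orthogonal to [v]; independence keeps [dot u f]
    nonzero. *)
Lemma dual_pair u v :
  (forall a b, a *: u + b *: v = 0 -> a = 0 /\ b = 0) ->
  exists e, dot u e = 1 /\ dot v e = 0.
Proof.
move=> uv; pose f := dot v v *: u - dot u v *: v.
have vf : dot v f = 0 by rewrite dotDr dotNr !dotZr (dotC v u); ring.
have uf0 : dot u f != 0.
  apply/eqP => uf0.
  have /dot_eq0 : dot f f = 0.
    by rewrite {1}/f dotDl dotNl !dotZl uf0 vf; ring.
  rewrite /f -scaleNr => /uv[/dot_eq0 v0 _].
  have [_ /eqP] := uv 0 1 (etrans (congr2 +%R (scale0r u) (etrans (scale1r v) v0)) (addr0 0)).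
  by rewrite oner_eq0.
exists ((dot u f)^-1 *: f); rewrite !dotZr vf mulr0; split=> //.
by rewrite mulVf.
Qed.

(** By polarisation [X *m A *m X^T = 0] for the kernel [X] of [K], so [X *m A] sits in the
    annihilator of [X], of dimension at most [k]; likewise for [B]. The stacked matrix restricted to
    [X] has rank at most [2 * k], and lifting the restriction costs at most [k] more. *)
Lemma rank_isotropic_pair k (K : 'M[R]_(n, k)) A B : A^T = A -> B^T = B ->
  (forall z, z *m K = 0 -> bf A z z = 0 /\ bf B z z = 0) ->
  (\rank (A + B)%MS <= 3 * k)%N.
Proof.
move=> sA sB isoAB; set X := kermx K.
have Xr i : row i X *m K = 0 by rewrite -row_mul mulmx_ker row0.
have rX : (n <= \rank X + k)%N.
  by rewrite mxrank_ker; have := rank_leq_col K; move: (\rank K) => r; lia.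
have rXM M : M^T = M -> (forall z, z *m K = 0 -> bf M z z = 0) ->
    (\rank (M *m X^T) <= k)%N.
  move=> sM isoM.
  have XMX : X *m M *m X^T = 0.
    apply/matrixP => i j; rewrite mxE [RHS]mxE.
    transitivity (bf M (row i X) (row j X)); last first.
      by rewrite (bf_polar _ _ sM) !isoM ?mulmxDl ?Xr ?addr0 //; field.
    rewrite /bf dotE -row_mul.
    by apply: eq_bigr => l _; rewrite !mxE.
  have := mxrank_mul_min (X *m M) X^T; rewrite XMX mxrank0 mxrank_tr.
  rewrite -(mxrank_tr (M *m X^T)) trmx_mul trmxK sM.
  by move: (\rank X) (\rank (X *m M)) rX => x xm rX; lia.
have rA := rXM A sA (fun z zK => (isoAB z zK).1).
have rB := rXM B sB (fun z zK => (isoAB z zK).2).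
have := mxrank_mul_min (col_mx A B) X^T; rewrite mul_col_mx -!addsmxE mxrank_tr.
have := (mxrank_adds_leqif (A *m X^T) (B *m X^T)).1.
move: (\rank X) (\rank (A + B)%MS) (\rank (A *m X^T + B *m X^T)%MS) rX rA rB.
move: (\rank (A *m X^T)) (\rank (B *m X^T)) => p q x r t rX rA rB; lia.
Qed.

End BilinearForms.

(** * Indefinite quadratic forms: isotropic vectors, proportionality, the S-lemma *)

Section IndefiniteForms.
Set Implicit Arguments. Unset Strict Implicit. Unset Printing Implicit Defensive.
Context {R : realType} {n : nat}.
Implicit Types (M A B P Q : 'M[R]_n) (u v w z p m : 'rV[R]_n) (a b t : R).

(** [t1] and [t2] are the roots of [c * t ^+ 2 + 2 * b * t + a], recorded through Vieta's relations;
    [a * c < 0] separates their signs. *)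
Lemma quadratic_roots a b (c : R) : 0 < a -> c < 0 ->
  exists t1 t2, [/\ t1 < 0, 0 < t2, a = c * t1 * t2 & 2 * b = - c * (t1 + t2)].
Proof.
move=> a0 c0; pose D := Num.sqrt (b ^+ 2 - a * c).
have ac : a * c < 0 by rewrite pmulr_rlt0.
have D2 : D ^+ 2 = b ^+ 2 - a * c by rewrite sqr_sqrtr//; have := sqr_ge0 b; lra.
have D0 : 0 <= D by exact: sqrtr_ge0.
have bD : `|b| < D by rewrite -(ltr_pXn2r (n:=2)) ?nnegrE// D2 real_normK ?num_real //; lra.
have [bD1 bD2] : - D < b /\ b < D by move: bD; rewrite ltr_norml => /andP.
have cn : c != 0 by lra.
exists ((- b + D) / c), ((- b - D) / c); split.
- by rewrite pmulr_rlt0 ?invr_lt0; lra.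
- by rewrite nmulr_rgt0 ?invr_lt0; lra.
- have -> : c * ((- b + D) / c) * ((- b - D) / c) = (b ^+ 2 - D ^+ 2) / c by field.
  by rewrite D2; field.
- by field.
Qed.

Lemma indefinite_plane Q p m : Q^T = Q -> 0 < bf Q p p -> bf Q m m < 0 ->
  exists t1 t2, [/\ t1 < 0, 0 < t2, bf Q p p = bf Q m m * t1 * t2,
    bf Q (p + t1 *: m) (p + t1 *: m) = 0 &
    bf Q (p + t2 *: m) (p + t2 *: m) = 0].
Proof.
move=> sQ Qp Qm; have [t1 [t2 [t1n t2p e1 e2]]] := quadratic_roots (bf Q p m) Qp Qm.
exists t1, t2; split=> //; rewrite !bfE (bfC m p sQ).
- transitivity (bf Q p p + 2 * bf Q p m * t1 + t1 ^+ 2 * bf Q m m); first by ring.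
  by rewrite e1 e2; ring.
- transitivity (bf Q p p + 2 * bf Q p m * t2 + t2 ^+ 2 * bf Q m m); first by ring.
  by rewrite e1 e2; ring.
Qed.

(** On the plane of a [Q]-positive and a [Q]-negative vector, [P] vanishes on both isotropic lines
    of [Q], which fixes one common ratio. Comparison with [p] and [m] makes this ratio uniform on
    [S]. *)
Lemma proportional_on_subspace (S : 'rV[R]_n -> Prop) Q P p m :
  (forall t u v, S u -> S v -> S (u + t *: v)) ->
  Q^T = Q -> P^T = P ->
  (forall z, S z -> bf Q z z = 0 -> bf P z z = 0) ->
  S p -> 0 < bf Q p p -> S m -> bf Q m m < 0 ->
  exists b, forall z, S z -> bf P z z = b * bf Q z z.
Proof.
move=> Slin sQ sP QP Sp Qp Sm Qm.
have cross p' m' : S p' -> S m' -> 0 < bf Q p' p' -> bf Q m' m' < 0 ->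
    bf P p' p' * bf Q m' m' = bf P m' m' * bf Q p' p'.
  move=> Sp' Sm' Qp' Qm'.
  have [t1 [t2 [t1n t2p e q1 q2]]] := indefinite_plane sQ Qp' Qm'.
  have := QP _ (Slin t1 _ _ Sp' Sm') q1; have := QP _ (Slin t2 _ _ Sp' Sm') q2.
  rewrite !bfE (bfC m' p' sP) => P2 P1.
  (* The weights [t2] and [- t1] cancel the cross term [bf P p' m']. *)
  have /eqP : (t2 - t1) * (bf P p' p' - t1 * t2 * bf P m' m') = 0.
    transitivity (t2 * 0 - t1 * 0 : R); last by ring.
    by rewrite -{1}P1 -P2; ring.
  rewrite mulf_eq0 => /orP[/eqP|/eqP]; first by lra.
  by move/eqP; rewrite subr_eq0 => /eqP ->; rewrite e; ring.
exists (bf P p p / bf Q p p) => z Sz.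
have Qp0 : bf Q p p != 0 by rewrite gt_eqF.
have Qm0 : bf Q m m != 0 by rewrite lt_eqF.
have [Qz|Qz|Qz] := ltgtP (bf Q z z) 0.
- have e := cross _ _ Sp Sz Qp Qz.
  by apply: (mulIf Qp0); rewrite -e; field.
- have e1 := cross _ _ Sz Sm Qz Qm; have e2 := cross _ _ Sp Sm Qp Qm.
  apply: (mulIf Qm0); rewrite e1; apply: (mulIf Qp0).
  transitivity (bf P m m * bf Q p p * bf Q z z); first by ring.
  by rewrite -e2; field.
- by rewrite Qz mulr0; exact: QP.
Qed.

(** Combining the values at the two isotropic vectors of a plane with the positive weights [t2],
    [- t1] cancels the cross term. Hence the ratio of [B] to [A] at [A]-negative vectors never
    exceeds that at [A]-positive ones; [t] is minus the infimum of the latter. *)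
Lemma S_lemma A B p m : A^T = A -> B^T = B ->
  0 < bf A p p -> bf A m m < 0 ->
  (forall z, bf A z z = 0 -> 0 <= bf B z z) ->
  exists t, forall z, 0 <= bf (B + t *: A) z z.
Proof.
move=> sA sB Ap Am AB.
have cross p' m' : 0 < bf A p' p' -> bf A m' m' < 0 ->
    bf B m' m' / bf A m' m' <= bf B p' p' / bf A p' p'.
  move=> Ap' Am'.
  have [t1 [t2 [t1n t2p e q1 q2]]] := indefinite_plane sA Ap' Am'.
  have := AB _ q1; have := AB _ q2; rewrite !bfE (bfC m' p' sB) => B2 B1.
  have : 0 <= (t2 - t1) * (bf B p' p' - t1 * t2 * bf B m' m').
    have := addr_ge0 (mulr_ge0 (ltW t2p) B1) (mulr_ge0 (_ : 0 <= - t1) B2).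
    by move=> /(_ ltac:(lra)); congr (0 <= _); ring.
  rewrite pmulr_rge0 ?subr_gt0; last by lra.
  rewrite subr_ge0 => h; rewrite ler_pdivlMr//.
  by move: h; rewrite {1}e; congr (_ <= _); field; rewrite lt_eqF.
pose E : set R := [set r | exists2 z, 0 < bf A z z & r = bf B z z / bf A z z].
have E0 : E !=set0 by exists (bf B p p / bf A p p); exists p.
have Elb m' : bf A m' m' < 0 -> lbound E (bf B m' m' / bf A m' m').
  by move=> Am' _ [z Az ->]; exact: cross.
exists (- inf E) => z; rewrite !bfE.
have [Az|Az|Az] := ltgtP (bf A z z) 0.
- have := lb_le_inf E0 (Elb _ Az); rewrite ler_ndivrMr//; lra.
- have : inf E <= bf B z z / bf A z z.
    by apply: ge_inf; [exists (bf B m m / bf A m m); exact: Elb | exists z].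
  by rewrite ler_pdivlMr//; lra.
- by rewrite Az mulr0 addr0; exact: AB.
Qed.

(** Double roots force the quartic to be [c4 * (t - t1) ^+ 2 * (t - t2) ^+ 2], here evaluated at
    [0]. *)
Lemma quartic_double_roots (c0 c1 c2 c3 c4 t1 t2 : R) : t1 < 0 -> 0 < t2 ->
  c0 + c1 * t1 + c2 * t1 ^+ 2 + c3 * t1 ^+ 3 + c4 * t1 ^+ 4 = 0 ->
  c0 + c1 * t2 + c2 * t2 ^+ 2 + c3 * t2 ^+ 3 + c4 * t2 ^+ 4 = 0 ->
  c1 + 2 * c2 * t1 + 3 * c3 * t1 ^+ 2 + 4 * c4 * t1 ^+ 3 = 0 ->
  c1 + 2 * c2 * t2 + 3 * c3 * t2 ^+ 2 + 4 * c4 * t2 ^+ 3 = 0 ->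
  c0 = c4 * (t1 * t2) ^+ 2.
Proof.
move=> t1n t2p f1 f2 g1 g2; pose d := t1 - t2.
have d0 : d ^+ 3 != 0 by rewrite expf_neq0// lt_eqF// /d; lra.
apply: (mulfI d0).
(* The weights are those of cubic Hermite interpolation at [0] with nodes [t1], [t2], multiplied by
   [d ^+ 3]. *)
transitivity (d ^+ 3 * (c4 * (t1 * t2) ^+ 2) + ((d + 2 * t1) * t2 ^+ 2 * 0
  + (d - 2 * t2) * t1 ^+ 2 * 0 - d * t1 * t2 ^+ 2 * 0 - d * t2 * t1 ^+ 2 * 0 : R)).
  by rewrite -{1}f1 -{1}f2 -{1}g1 -g2 /d; ring.
by ring.
Qed.

Lemma indep_of_minor u v w z :
  dot u w * dot v z - dot u z * dot v w != 0 ->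
  forall a b, a *: u + b *: v = 0 -> a = 0 /\ b = 0.
Proof.
set D := (X in X != 0) => D0 a b ab.
have e x : a * dot u x + b * dot v x = 0 by rewrite -!dotZl -dotDl ab dot0l.
split; apply: (mulIf D0); rewrite mul0r.
  transitivity (dot v z * (0 : R) - dot v w * 0); last by ring.
  by rewrite -{1}(e w) -(e z) /D; ring.
transitivity (dot u w * (0 : R) - dot u z * 0); last by ring.
by rewrite -{1}(e z) -(e w) /D; ring.
Qed.

End IndefiniteForms.

(** * Existence of a regular common zero *)

Section RegularZero.
Set Implicit Arguments. Unset Strict Implicit. Unset Printing Implicit Defensive.
Context {R : realType} {n : nat}.
Implicit Types (M A B P Q : 'M[R]_n) (u v w z p m : 'rV[R]_n) (a b t : R).

(** The substitution [t = x / (1 - x)] carries the unit interval to the positive half-line; after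
    multiplication by [(1 - x) ^+ 4] the endpoint values are [c0] and [c4]. *)
Lemma quartic_pos_root (c0 c1 c2 c3 c4 : R) : 0 < c0 -> c4 < 0 ->
  exists2 t, 0 < t &
    c0 + c1 * t + c2 * t ^+ 2 + c3 * t ^+ 3 + c4 * t ^+ 4 = 0.
Proof.
move=> c0p c4n.
pose p : {poly R} := - (c0%:P * (1 - 'X) ^+ 4 + c1%:P * 'X * (1 - 'X) ^+ 3
  + c2%:P * 'X ^+ 2 * (1 - 'X) ^+ 2 + c3%:P * 'X ^+ 3 * (1 - 'X) + c4%:P * 'X ^+ 4).
have pE x : p.[x] = - (c0 * (1 - x) ^+ 4 + c1 * x * (1 - x) ^+ 3
  + c2 * x ^+ 2 * (1 - x) ^+ 2 + c3 * x ^+ 3 * (1 - x) + c4 * x ^+ 4).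
  by rewrite /p !hornerE.
have p0 : p.[0] = - c0 by rewrite pE; ring.
have p1 : p.[1] = - c4 by rewrite pE; ring.
have [||x /andP[x0 x1] /rootP px] := @poly_ivt _ p 0 1; first exact: ler01.
  by rewrite p0 p1; lra.
have xn0 : x != 0 by apply/eqP => x0'; move: px; rewrite x0' p0; lra.
have xn1 : x != 1 by apply/eqP => x1'; move: px; rewrite x1' p1; lra.
have x0' : 0 < x by rewrite lt_neqAle eq_sym xn0.
have x1' : x < 1 by rewrite lt_neqAle xn1.
exists (x / (1 - x)); first by rewrite divr_gt0// subr_gt0.
have y0 : 1 - x != 0 by lra.
have y4 : (1 - x) ^+ 4 != 0 by rewrite expf_neq0.
apply: (mulIf y4); rewrite mul0r -oppr0 -px pE opprK; field.
by rewrite y0.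
Qed.

(** There is a root on each side of [0]; were both double, [c0] would be [c4] times a square,
    against the signs. *)
Lemma quartic_simple_root (c0 c1 c2 c3 c4 : R) : 0 < c0 -> c4 < 0 ->
  exists t, [/\ t != 0,
    c0 + c1 * t + c2 * t ^+ 2 + c3 * t ^+ 3 + c4 * t ^+ 4 = 0 &
    c1 + 2 * c2 * t + 3 * c3 * t ^+ 2 + 4 * c4 * t ^+ 3 != 0].
Proof.
move=> c0p c4n.
have [t2 t2p f2] := quartic_pos_root c1 c2 c3 c0p c4n.
have [t1' t1p f1'] := quartic_pos_root (- c1) c2 (- c3) c0p c4n.
pose t1 := - t1'; have t1n : t1 < 0 by rewrite /t1; lra.
have f1 : c0 + c1 * t1 + c2 * t1 ^+ 2 + c3 * t1 ^+ 3 + c4 * t1 ^+ 4 = 0.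
  by rewrite -f1' /t1; ring.
have [g1|g1] := eqVneq (c1 + 2 * c2 * t1 + 3 * c3 * t1 ^+ 2 + 4 * c4 * t1 ^+ 3) 0;
  last by exists t1; split=> //; rewrite lt_eqF.
have [g2|g2] := eqVneq (c1 + 2 * c2 * t2 + 3 * c3 * t2 ^+ 2 + 4 * c4 * t2 ^+ 3) 0;
  last by exists t2; split=> //; rewrite gt_eqF.
have e := quartic_double_roots t1n t2p f1 f2 g1 g2.
have := sqr_ge0 (t1 * t2) => h.
have : c4 * (t1 * t2) ^+ 2 <= 0 by rewrite mulr_le0_ge0// ltW.
by rewrite -e; lra.
Qed.

Lemma not_forall_ge0 A : ~ (forall z, 0 <= bf A z z) -> exists z, bf A z z < 0.
Proof. by move=> /existsNP[z /negP]; rewrite -ltNge; exists z. Qed.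

(** At a simple root along the conic, the velocity [y'] is [A]-orthogonal but not [B]-orthogonal to
    [y], while [bf A y z] is nonzero: the minor on [z], [y'] does not vanish. *)
Lemma regular_zero_nonorthogonal A B z w v : A^T = A -> B^T = B ->
  bf A z z = 0 -> bf A w w = 0 -> bf A z w != 0 ->
  bf A z v = 0 -> bf A w v = 0 -> bf A v v != 0 ->
  0 < bf B z z -> bf B w w < 0 ->
  exists y, [/\ bf A y y = 0, bf B y y = 0 &
    forall a b, a *: (y *m A) + b *: (y *m B) = 0 -> a = 0 /\ b = 0].
Proof.
move=> sA sB Az Aw Azw vz vw Av Bz Bw.
(* This scaling gives [bf A v v + 2 * bf A z w' = 0], which keeps the conic on the quadric of
   [A]. *)
pose c := - bf A v v / (2 * bf A z w).
have c0 : c != 0 by rewrite mulf_neq0 ?oppr_eq0 ?invr_eq0 ?mulf_neq0// pnatr_eq0.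
pose w' := c *: w.
have Aw' : bf A w' w' = 0 by rewrite !bfE Aw !mulr0.
have Bw' : bf B w' w' < 0.
  rewrite !bfE mulrA pmulr_rlt0//.
  by rewrite -expr2 exprn_even_gt0.
have Azw' : 2 * bf A z w' = - bf A v v by rewrite !bfE /c; field.
have Azw0 : bf A z w' != 0 by rewrite bfE mulf_neq0.
have Awv' : bf A v w' = 0 by rewrite bfE (bfC v w sA) vw mulr0.
clearbody w'.
have [t [t0 ft f't]] := quartic_simple_root (2 * bf B z v)
  (bf B v v + 2 * bf B z w') (2 * bf B v w') Bz Bw'.
exists (z + t *: v + t ^+ 2 *: w'); set y := z + _ + _; set y' := v + (2 * t) *: w'.
have By : bf B y y = 0.
  by rewrite -ft /y !bfE (bfC v z sB) (bfC w' z sB) (bfC w' v sB); ring.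
have By' : bf B y y' != 0.
  apply: contraNneq f't => By'; apply/eqP.
  transitivity (2 * bf B y y'); last by rewrite By' mulr0.
  by rewrite /y /y' !bfE (bfC w' v sB); ring.
have Ay : bf A y y = 0.
  rewrite /y !bfDl !bfDr !bfZl !bfZr (bfC v z sA) (bfC w' z sA) (bfC w' v sA).
  rewrite vz Az Aw' Awv'; transitivity (t ^+ 2 * (bf A v v + 2 * bf A z w')).
    by ring.
  by rewrite Azw'; ring.
have Ay' : bf A y y' = 0.
  rewrite /y /y' !bfDl !bfDr !bfZl !bfZr (bfC w' v sA).
  rewrite vz Aw' Awv'; transitivity (t * (bf A v v + 2 * bf A z w')).
    by ring.
  by rewrite Azw'; ring.
have Ayz : bf A y z != 0.
  rewrite /y !bfDl !bfZl Az (bfC v z sA) vz (bfC w' z sA) mulr0 !add0r.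
  by rewrite mulf_neq0// expf_neq0.
split=> //; apply: (@indep_of_minor _ _ _ _ z y').
by rewrite -![dot _ _]/(bf _ _ _) Ay' mul0r subr0 mulf_neq0.
Qed.

(** The whole line [z + t *: w] is [A]-isotropic, and the form of [B] has two simple roots on it. A
    root can fail to be regular only inside the kernel of [A]; if both were there, so would be
    [z]. *)
Lemma regular_zero_orthogonal A B z w : A^T = A -> B^T = B ->
  z *m A != 0 -> bf A z z = 0 -> bf A w w = 0 -> bf A z w = 0 ->
  0 < bf B z z -> bf B w w < 0 ->
  exists y, [/\ bf A y y = 0, bf B y y = 0 &
    forall a b, a *: (y *m A) + b *: (y *m B) = 0 -> a = 0 /\ b = 0].
Proof.
move=> sA sB zA Az Aw Azw Bz Bw.
have [t1 [t2 [t1n t2p e q1 q2]]] := indefinite_plane sB Bz Bw.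
have key t t' : t * t' < 0 -> bf B z z = bf B w w * t * t' ->
   bf B (z + t *: w) (z + t *: w) = 0 -> (z + t *: w) *m A != 0 ->
  exists y, [/\ bf A y y = 0, bf B y y = 0 &
    forall a b, a *: (y *m A) + b *: (y *m B) = 0 -> a = 0 /\ b = 0].
  move=> tt' e' By yA; exists (z + t *: w); set y := z + _.
  split=> //; first by rewrite !bfE (bfC w z sA) Az Aw Azw; ring.
  have Ayw : bf A y w = 0 by rewrite !bfE Azw Aw; ring.
  have Byw : bf B y w != 0.
    apply/eqP => Byw.
    have : bf B z z - t ^+ 2 * bf B w w = 0.
      transitivity (bf B y y - 2 * t * bf B y w); last by rewrite By Byw; ring.
      by rewrite /y !bfE (bfC w z sB); ring.
    by have := sqr_ge0 t; nra.
  apply: (@indep_of_minor _ _ _ _ (y *m A) w).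
  rewrite -![dot _ w]/(bf _ _ _) Ayw mul0r subr0 mulf_neq0//.
  by apply: contra_neq yA; exact: dot_eq0.
have [y1|y1] := eqVneq ((z + t1 *: w) *m A) 0; last first.
  by apply: (key t1 t2) => //; rewrite nmulr_rlt0.
have [y2|y2] := eqVneq ((z + t2 *: w) *m A) 0; last first.
  apply: (key t2 t1) => //; last by rewrite e; ring.
  by rewrite pmulr_rlt0.
case/eqP: zA.
have : (t2 - t1) *: (z *m A) = 0.
  rewrite scalemxAl.
  have -> : (t2 - t1) *: z = t2 *: (z + t1 *: w) - t1 *: (z + t2 *: w).
    rewrite scalerBl !scalerDr !scalerA (mulrC t1 t2) opprD addrACA subrr addr0 //.
  by rewrite mulmxBl -!scalemxAl y1 y2 !scaler0 subr0.
by move=> /eqP; rewrite scaler_eq0 => /orP[|/eqP//]; rewrite gt_eqF// subr_gt0; lra.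
Qed.

(** If [A] vanishes on the vectors [A]-orthogonal to [z] and [w], it vanishes on those
    [A]-orthogonal to [z]: subtracting a multiple of [z] reaches the former without changing
    [bf A y y]. *)
Lemma regular_zero_or_degenerate A B z w : A^T = A -> B^T = B ->
  bf A z z = 0 -> bf A w w = 0 -> bf A z w != 0 ->
  0 < bf B z z -> bf B w w < 0 ->
  (exists y, [/\ bf A y y = 0, bf B y y = 0 &
    forall a b, a *: (y *m A) + b *: (y *m B) = 0 -> a = 0 /\ b = 0]) \/
  (exists2 h, h != 0 & forall y, dot y h = 0 -> bf A y y = 0).
Proof.
move=> sA sB Az Aw Azw Bz Bw.
have [[v [vz vw Av]]|nv] :=
    pselect (exists v, [/\ bf A z v = 0, bf A w v = 0 & bf A v v != 0]).
  by left; exact: (regular_zero_nonorthogonal sA sB Az Aw Azw vz vw Av).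
right; exists (z *m A).
  by apply: contra_neq Azw => zA; rewrite /bf zA dot0l.
move=> y; rewrite dotC -[dot _ _]/(bf A z y) => Azy.
pose v := y - (bf A w y / bf A z w) *: z.
have vz : bf A z v = 0 by rewrite /v !bfE Azy Az; ring.
have vw : bf A w v = 0 by rewrite /v !bfE (bfC w z sA); field.
have vv : bf A v v = bf A y y by rewrite /v !bfE (bfC y z sA) Azy Az; ring.
by apply: contrapT => /eqP Ay; apply: nv; exists v; rewrite vv.
Qed.

Lemma regular_zero A B : A^T = A -> B^T = B ->
  (forall a b, a *: A + b *: B = 0 -> a = 0 /\ b = 0) ->
  (forall a b, (forall z, 0 <= bf (a *: A + b *: B) z z) -> a *: A + b *: B = 0) ->
  (exists y, [/\ bf A y y = 0, bf B y y = 0 &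
    forall a b, a *: (y *m A) + b *: (y *m B) = 0 -> a = 0 /\ b = 0]) \/
  (exists2 h, h != 0 & forall y, dot y h = 0 -> bf A y y = 0).
Proof.
move=> sA sB indAB nd.
have indef a b : (a != 0) || (b != 0) -> exists z, bf (a *: A + b *: B) z z < 0.
  move=> ab; apply: not_forall_ge0 => /nd/indAB[a0 b0].
  by move: ab; rewrite a0 b0 eqxx.
have [m Am] : exists m, bf A m m < 0.
  have [|m] := indef 1 0; first by rewrite oner_eq0.
  by rewrite scale1r scale0r addr0; exists m.
have [p Ap] : exists p, 0 < bf A p p.
  have [|p] := indef (-1) 0; first by rewrite oppr_eq0 oner_eq0.
  by rewrite scaleN1r scale0r addr0 bfNm oppr_lt0; exists p.
have signB b : b != 0 -> exists z, bf A z z = 0 /\ b * bf B z z < 0.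
  move=> b0; apply: contrapT => nz.
  have sbB : (b *: B)^T = b *: B by rewrite linearZ/= sB.
  have [z Az|t tP] := S_lemma sA sbB Ap Am.
    by rewrite bfE leNgt; apply/negP => Bz; apply: nz; exists z.
  have [|z] := indef t b; first by rewrite b0 orbT.
  by rewrite addrC ltNge tP.
have [w [Aw]] := signB 1 (oner_neq0 _); rewrite mul1r => Bw.
have [|z [Az]] := signB (-1); first by rewrite oppr_eq0 oner_eq0.
rewrite mulN1r oppr_lt0 => Bz.
have [Azw|Azw] := eqVneq (bf A z w) 0; last first.
  exact: (regular_zero_or_degenerate sA sB Az Aw Azw).
have [zA|zA] := eqVneq (z *m A) 0; last first.
  by left; exact: (regular_zero_orthogonal sA sB zA Az Aw Azw).
(* In the remaining case [z] lies in the kernel of [A]. It is shifted slightly along an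
   [A]-isotropic [g] outside that kernel, which keeps it [A]-isotropic. *)
have [t1 [t2 [t1n t2p e q1 q2]]] := indefinite_plane sA Ap Am.
pose g := p + t1 *: m; have Ag : bf A g g = 0 by [].
have gA : g *m A != 0.
  apply/eqP => gA.
  have : bf A g p = 0 by rewrite /bf gA dot0l.
  have : bf A g m = 0 by rewrite /bf gA dot0l.
  rewrite /g !bfE => e1; rewrite (bfC m p sA) => e2.
  have : bf A p p = t1 ^+ 2 * bf A m m.
    transitivity (bf A p p + t1 * bf A p m - t1 * (bf A p m + t1 * bf A m m)
      + t1 ^+ 2 * bf A m m); first by ring.
    by rewrite e1 e2; ring.
  by have := sqr_ge0 t1; nra.
clearbody g.
have [eps [eps0 Bz']] : exists eps, eps != 0 /\
    0 < bf B (z + eps *: g) (z + eps *: g).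
  (* For [eps] at most [1] the shift lowers the [B]-value by at most [eps * K], hence by at most
     half of [bf B z z]. *)
  pose K := 1 + 2 * `|bf B z g| + `|bf B g g|.
  have K1 : 1 <= K by rewrite /K; have := normr_ge0 (bf B z g); have := normr_ge0 (bf B g g); lra.
  pose eps := Num.min 1 (bf B z z / (2 * K)).
  have eps0 : 0 < eps by rewrite lt_min ltr01/= divr_gt0//; lra.
  have eps1 : eps <= 1 by rewrite ge_min lexx.
  have epsK : eps * (2 * K) <= bf B z z.
    by rewrite -ler_pdivlMr; [rewrite ge_min lexx orbT | lra].
  exists eps; split; first by rewrite gt_eqF.
  rewrite !bfE (bfC g z sB).
  have := ler_norm (- bf B z g); have := ler_norm (- bf B g g).
  rewrite !normrN => h1 h2.
  have h3 : - (eps * `|bf B g g|) <= eps * (eps * bf B g g).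
    rewrite -mulrN; apply: ler_wpM2l; first exact: ltW.
    have : - (eps * bf B g g) <= `|bf B g g|.
      rewrite -mulrN; apply: (le_trans (ler_norm _)); rewrite normrM normrN.
      by rewrite ler_piMl// ger0_norm// ltW.
    lra.
  have h4 : - (eps * `|bf B z g|) <= eps * bf B z g.
    by rewrite -mulrN; apply: ler_wpM2l; [exact: ltW | lra].
  move: epsK; rewrite /K; lra.
have Az' : bf A (z + eps *: g) (z + eps *: g) = 0.
  by rewrite !bfE Az Ag (bfC g z sA) /bf zA dot0l; ring.
have [Azw'|Azw'] := eqVneq (bf A (z + eps *: g) w) 0; last first.
  exact: (regular_zero_or_degenerate sA sB Az' Aw Azw').
left; apply: (regular_zero_orthogonal sA sB _ Az' Aw Azw') => //.
by rewrite mulmxDl zA add0r -scalemxAl scaler_eq0 negb_or eps0.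
Qed.

End RegularZero.

(** * Bounded Lipschitz functions and a scalar implicit function theorem *)

Section BoundedLipschitz.
Set Implicit Arguments. Unset Strict Implicit. Unset Printing Implicit Defensive.
Context {R : realType}.

(** Boundedness is included to make the class closed under products; [dist] is abstract so that the
    same rules serve functions of [s] and of the pair [(s, g)]. *)
Definition blip (T : Type) (D : T -> Prop) (dist : T -> T -> R) (f : T -> R) :=
  exists K : R, [/\ 0 <= K, forall x, D x -> `|f x| <= K &
    forall x y, D x -> D y -> `|f x - f y| <= K * dist x y].

Lemma blip_weaken (T : Type) (D D' : T -> Prop) dist f :
  (forall x, D' x -> D x) -> blip D dist f -> blip D' dist f.
Proof.
move=> DD [K [K0 Kb Kl]]; exists K; split=> //; first by move=> x /DD; exact: Kb.
by move=> x y /DD Dx /DD Dy; exact: Kl.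
Qed.

Lemma blip_cst (T : Type) (D : T -> Prop) dist (c : R) :
  (forall x y, 0 <= dist x y) -> blip D dist (fun=> c).
Proof.
by move=> d0; exists `|c|; split=> // x y _ _; rewrite subrr normr0 mulr_ge0.
Qed.

Lemma blipD (T : Type) (D : T -> Prop) dist (f g : T -> R) :
  blip D dist f -> blip D dist g -> blip D dist (fun x => f x + g x).
Proof.
move=> [K [K0 Kb Kl]] [L [L0 Lb Ll]]; exists (K + L); split; first exact: addr_ge0.
  move=> x Dx; apply: le_trans (ler_normD _ _) _.
  by apply: lerD; [exact: Kb | exact: Lb].
move=> x y Dx Dy; rewrite opprD addrACA mulrDl.
apply: le_trans (ler_normD _ _) _.
by apply: lerD; [exact: Kl | exact: Ll].
Qed.

Lemma blipM (T : Type) (D : T -> Prop) dist (f g : T -> R) :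
  (forall x y, 0 <= dist x y) ->
  blip D dist f -> blip D dist g -> blip D dist (fun x => f x * g x).
Proof.
move=> d0 [K [K0 Kb Kl]] [L [L0 Lb Ll]]; exists (2 * (K * L)).
have KL : 0 <= K * L by exact: mulr_ge0.
split; first by lra.
  move=> x Dx; rewrite normrM; apply: (@le_trans _ _ (K * L)); last by lra.
  by apply: ler_pM => //; [exact: Kb | exact: Lb].
move=> x y Dx Dy.
have -> : f x * g x - f y * g y = f x * (g x - g y) + (f x - f y) * g y by ring.
apply: le_trans (ler_normD _ _) _; rewrite !normrM.
have -> : 2 * (K * L) * dist x y = K * (L * dist x y) + K * dist x y * L by ring.
apply: lerD; apply: ler_pM => //.
- exact: Kb.
- exact: Ll.
- exact: Kl.
- exact: Lb.
Qed.

Lemma blipN (T : Type) (D : T -> Prop) dist (f : T -> R) :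
  blip D dist f -> blip D dist (fun x => - f x).
Proof.
move=> [K [K0 Kb Kl]]; exists K; split=> // [x Dx|x y Dx Dy].
  by rewrite normrN; exact: Kb.
by rewrite -opprD normrN; exact: Kl.
Qed.

Definition seg (d : R) : R -> Prop := fun s => `|s| <= d.
Definition segd (s t : R) : R := `|s - t|.
Definition box (g0 : R) : R * R -> Prop :=
  fun p => `|p.1| <= 1 /\ `|p.2 - g0| <= 1.
Definition boxd (p q : R * R) : R := `|p.1 - q.1| + `|p.2 - q.2|.

Lemma segd_ge0 s t : 0 <= segd s t. Proof. exact: normr_ge0. Qed.
Lemma boxd_ge0 p q : 0 <= boxd p q. Proof. exact: addr_ge0. Qed.

Lemma blip_id d : 0 <= d -> blip (seg d) segd (fun s => s).
Proof.
move=> d0; exists (d + 1); split; first by lra.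
  by move=> x; rewrite /seg; lra.
by move=> x y _ _; rewrite ler_peMl//; lra.
Qed.

Lemma blip_fst g0 : blip (box g0) boxd (fun p => p.1).
Proof.
exists 1; split=> [//|x []//|x y _ _]; rewrite mul1r /boxd.
by rewrite lerDl.
Qed.

Lemma blip_snd g0 : blip (box g0) boxd (fun p => p.2).
Proof.
exists (`|g0| + 1); have g00 := normr_ge0 g0; split=> [|x [_ xg]|x y _ _].
- lra.
- by have := ler_normD (x.2 - g0) g0; rewrite subrK; lra.
- rewrite /boxd.
  have h1 := normr_ge0 (x.1 - y.1); have h2 := normr_ge0 (x.2 - y.2).
  have := mulr_ge0 g00 (addr_ge0 h1 h2); lra.
Qed.

(** Continuity at [0] allows an identity to be divided by [s] and then evaluated at [0], so that
    expansions are read off order by order. *)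
Lemma blip_zero_limit d (f : R -> R) : 0 < d -> blip (seg d) segd f ->
  (forall s : R, `|s| <= d -> s != 0 -> f s = 0) -> f 0 = 0.
Proof.
move=> d0 [K [K0 Kb Kl]] f0.
have [//|fn0] := eqVneq (f 0) 0; exfalso.
have f0p : 0 < `|f 0| by rewrite normr_gt0.
pose s := Num.min d (`|f 0| / (2 * (K + 1))).
have s0 : 0 < s by rewrite lt_min d0 divr_gt0//; lra.
have sd : `|s| <= d by rewrite gtr0_norm// ge_min lexx.
have sK : s * (2 * (K + 1)) <= `|f 0|.
  by rewrite -ler_pdivlMr; [rewrite ge_min lexx orbT | lra].
have D0 : seg d 0 by rewrite /seg normr0 ltW.
have := Kl _ _ D0 sd; rewrite /segd (f0 s)// ?gt_eqF// sub0r subr0 normrN (gtr0_norm s0).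
have Ks : 0 <= K * s by apply: mulr_ge0 => //; exact: ltW.
by lra.
Qed.

(* The scalar implicit function theorem for [g = g0 - s r(s, g)]. *)
Lemma implicit_fixpoint (r : R -> {poly R}) (g0 : R) :
  blip (box g0) boxd (fun p => (r p.1).[p.2]) ->
  exists (d : R) (g : R -> R), [/\ 0 < d, d <= 1,
    (forall s : R, `|s| <= d -> g s = g0 - s * (r s).[g s]) &
    blip (seg d) segd g].
Proof.
move=> [K [K0 Kb Kl]].
(* This radius keeps the perturbation [s * (r s).[x]] within [1 / 2]: enough for a sign change
   between [g0 - 1] and [g0 + 1], and for absorbing the distance of [g s] and [g t] in the Lipschitz
   estimate. *)
pose d := (2 * (K + 1))^-1.
have K1 : 0 < 2 * (K + 1) by lra.
have d0 : 0 < d by rewrite invr_gt0.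
have dK : d * (2 * (K + 1)) = 1 by rewrite mulVf// gt_eqF.
have d1 : d <= 1 by have : 0 <= d * K := mulr_ge0 (ltW d0) K0; lra.
have sK (s : R) : `|s| <= d -> `|s| * K <= 1 / 2.
  move=> sd; have : `|s| * K <= d * K by exact: ler_wpM2r.
  lra.
have ex (s : R) : exists g, `|s| <= d -> `|g - g0| <= 1 /\ g = g0 - s * (r s).[g].
  have [sd|sd] := leP `|s| d; last by exists 0.
  have s1 : `|s| <= 1 by exact: le_trans sd d1.
  pose p : {poly R} := 'X - g0%:P + s *: r s.
  have pE x : p.[x] = x - g0 + s * (r s).[x] by rewrite /p !hornerE.
  have bd x : `|x - g0| <= 1 -> `|s * (r s).[x]| <= 1 / 2.
    move=> xg; rewrite normrM; apply: (le_trans _ (sK _ sd)).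
    by apply: ler_wpM2l => //; exact: (Kb (s, x)).
  have b1 : `|g0 - 1 - g0| <= 1 by rewrite addrAC subrr add0r normrN normr1.
  have b2 : `|g0 + 1 - g0| <= 1 by rewrite addrAC subrr add0r normr1.
  have [||x /andP[x0 x1] /rootP px] := @poly_ivt _ p (g0 - 1) (g0 + 1); first by lra.
    have := bd _ b1; have := bd _ b2; rewrite !pE !ler_norml.
    by move=> /andP[? ?] /andP[? ?]; apply/andP; split; lra.
  exists x => _; split; first by rewrite ler_norml; apply/andP; split; lra.
  by move: px; rewrite pE; lra.
have [g gP] := choice ex.
exists d, g; split=> // [s sd|]; first by have [] := gP _ sd.
exists (2 * K + 2 + `|g0|); have g00 := normr_ge0 g0; split; first by lra.
  move=> s sd; have [gg _] := gP _ sd.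
  by have := ler_normD (g s - g0) g0; rewrite subrK; lra.
move=> s t sd td; have [gs es] := gP _ sd; have [gt et] := gP _ td.
have s1 : `|s| <= 1 by exact: le_trans sd d1.
have t1 : `|t| <= 1 by exact: le_trans td d1.
pose rs := (r s).[g s]; pose rt := (r t).[g t].
have e : g s - g t = - ((s - t) * rs + t * (rs - rt)).
  by rewrite {1}es {1}et -/rs -/rt; ring.
have h1 : `|rs| <= K by exact: (Kb (s, g s)).
have h2 : `|rs - rt| <= K * (`|s - t| + `|g s - g t|) by exact: (Kl (s, g s) (t, g t)).
have h3 : `|g s - g t| <= `|s - t| * K + `|t| * (K * (`|s - t| + `|g s - g t|)).
  rewrite {1}e normrN; apply: le_trans (ler_normD _ _) _; rewrite !normrM.
  by apply: lerD; apply: ler_wpM2l.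
have h4 := normr_ge0 (s - t); have h5 := normr_ge0 (g s - g t).
have h6 : `|t| * (K * (`|s - t| + `|g s - g t|)) <= 1 / 2 * (`|s - t| + `|g s - g t|).
  by rewrite mulrA; apply: ler_wpM2r; [exact: addr_ge0 | exact: sK].
have h7 : 0 <= `|g0| * `|s - t| by exact: mulr_ge0.
by rewrite /segd; lra.
Qed.

End BoundedLipschitz.

(** * Connectedness of curve segments *)

Section ConnectedCurve.
Set Implicit Arguments. Unset Strict Implicit. Unset Printing Implicit Defensive.
Context {R : realType} {n : nat}.

Lemma lipschitz_continuous (f : R -> R) K : 0 <= K ->
  (forall s t, `|f s - f t| <= K * `|s - t|) -> continuous f.
Proof.
move=> K0 fK s; apply/cvgrPdist_le => e e0.
have K1 : 0 < K + 1 by lra.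
have eK : 0 < e / (K + 1) by exact: divr_gt0.
near=> t; apply: le_trans (fK _ _) _.
have : `|s - t| <= e / (K + 1).
  near: t.
  by apply: filterS (nbhsx_ballx s _ eK) => t; rewrite /ball/= => /ltW.
rewrite ler_pdivlMr// => h; have := normr_ge0 (s - t); lra.
Unshelve. all: by end_near.
Qed.

Lemma connected_curve (d : R) (x u q w : 'rV[R]_n) (f g : R -> R) : 0 < d ->
  blip (seg d) segd f -> blip (seg d) segd g ->
  connected [set x + s *: u + f s *: q + g s *: w | s in `[- d, d]].
Proof.
move=> d0 bf bg.
(* Clamping extends the coefficients to globally continuous functions without changing the image of
   the interval. *)
pose c s := Num.max (- d) (Num.min s d).
have cd (s : R) : `|c s| <= d.
  by rewrite ler_norml /c le_max ge_max ge_min lexx orbT /=; lra.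
have cid (s : R) : `|s| <= d -> c s = s.
  rewrite ler_norml => /andP[h1 h2]; rewrite /c (min_idPl _)//.
  by apply/max_idPr.
have clip (s t : R) : `|c s - c t| <= `|s - t|.
  have := ler_norm (s - t); have := ler_norm (t - s); rewrite (distrC t s) => h1 h2.
  rewrite ler_norml /c; apply/andP; case: (leP s d) => ?; case: (leP t d) => ?;
    case: (leP (- d) s) => ?; case: (leP (- d) t) => ?;
    case: (leP (- d) d) => ?; split; lra.
have cont h : blip (seg d) segd h -> continuous (h \o c).
  move=> [K [K0 Kb Kl]]; apply: (lipschitz_continuous K0) => s t /=.
  by apply: le_trans (Kl _ _ (cd s) (cd t)) _; apply: ler_wpM2l => //; exact: clip.
have -> : [set x + s *: u + f s *: q + g s *: w | s in `[- d, d]] =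
  (fun s => x + s *: u + (f \o c) s *: q + (g \o c) s *: w) @` `[- d, d].
  apply: eq_imagel => s; rewrite /= in_itv/= -ler_norml => sd.
  by rewrite /= !cid.
apply: connected_continuous_connected.
  by apply/connected_intervalP; exact: interval_is_interval.
apply: continuous_subspaceT => s.
apply: cvgD; last by apply: cvgZr_tmp; exact: cont.
apply: cvgD; last by apply: cvgZr_tmp; exact: cont.
apply: cvgD; first exact: cvg_cst.
by apply: cvgZr_tmp; exact: cvg_id.
Qed.

End ConnectedCurve.

Ltac blip_tac := repeat first
  [ assumption | exact: segd_ge0 | exact: boxd_ge0
  | apply: blip_cst | apply: blip_fst | apply: blip_snd
  | apply: blipD | apply: blipN | apply: blipM ].

(** * Curves of regular zeros through a given one *)

Section LocalStructure.
Set Implicit Arguments. Unset Strict Implicit. Unset Printing Implicit Defensive.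
Context {R : realType} {n : nat}.
Implicit Types (M A B : 'M[R]_n) (u v w x y z q h : 'rV[R]_n) (a b s t : R).

(** [Nset] in arbitrary dimension; the two are convertible for [n = d + d]. *)
Definition regular_zeros A B : set 'rV[R]_n :=
  [set z | bf A z z = 0 /\ bf B z z = 0 /\
    forall a b : R, a *: (z *m A) + b *: (z *m B) = 0 -> a = 0 /\ b = 0].

(** Half of a dual basis to [x *m A], [x *m B], corrected by multiples of [x], to which both forms
    are blind at first order beyond the fixed pairings. The value [2^-1] makes the cross terms of
    the quadratic forms equal to [1]. *)
Lemma regular_zero_frame A B x : A^T = A -> B^T = B -> regular_zeros A B x ->
  exists w q, [/\ bf A x w = 2^-1, bf B x w = 0 & bf A w w = 0] /\
    [/\ bf A x q = 0, bf B x q = 2^-1 & bf A w q = 0].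
Proof.
move=> sA sB [Ax [Bx indx]].
have [e1 [Ae1 Be1]] := dual_pair indx.
have [|e2 [Be2 Ae2]] := @dual_pair _ _ (x *m B) (x *m A).
  by move=> a b; rewrite addrC => /indx[].
have {}Ae1 : bf A x e1 = 1 by []. have {}Be1 : bf B x e1 = 0 by [].
have {}Ae2 : bf A x e2 = 0 by []. have {}Be2 : bf B x e2 = 1 by [].
have [w [Aw Bw Aww]] : exists w, [/\ bf A x w = 2^-1, bf B x w = 0 & bf A w w = 0].
  exists (2^-1 *: e1 - (bf A e1 e1 / 4) *: x); split.
  - by rewrite !bfE Ae1 Ax; field.
  - by rewrite !bfE Be1 Bx; field.
  - by rewrite !bfE (bfC e1 x sA) Ae1 Ax; field.
exists w, (2^-1 *: e2 - bf A w e2 *: x); split=> //; split.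
- by rewrite !bfE Ae2 Ax; field.
- by rewrite !bfE Be2 Bx; field.
- by rewrite !bfE (bfC w x sA) Aw; field.
Qed.

(** The condition [bf A w u = 0] normalises a tangent direction modulo [x]. The values of [c1], [c2]
    at [0] are the second-order coefficients, to be compared later with a hyperplane. *)
Lemma regular_zero_curve A B x w q u : A^T = A -> B^T = B ->
  regular_zeros A B x ->
  bf A x w = 2^-1 -> bf B x w = 0 -> bf A w w = 0 ->
  bf A x q = 0 -> bf B x q = 2^-1 -> bf A w q = 0 ->
  bf A x u = 0 -> bf A w u = 0 -> bf B x u = 0 ->
  exists (d : R) (c1 c2 : R -> R),
    [/\ 0 < d, blip (seg d) segd c1 /\ blip (seg d) segd c2,
      c1 0 = - bf B u u /\ c2 0 = - bf A u u &
      forall s : R, `|s| <= d -> connected_component (regular_zeros A B) x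
        (x + s *: u + (s * s * c1 s) *: q + (s * s * c2 s) *: w)].
Proof.
move=> sA sB Nx Axw Bxw Aww Axq Bxq Awq Axu Awu Bxu.
have [Ax [Bx _]] := Nx.
(* The point [x + e - bf A e e *: w] lies on the quadric of [A] for every [e] that is
   [A]-orthogonal to [x] and [w]; take [e = s *: u + (s * s * g) *: q].  After
   division by [s * s], the equation for [B] reads [g = - bf B u u - s * r s g]. *)
pose ap s : {poly R} := (bf A u u)%:P + (2 * s * bf A u q)%:P * 'X
  + (s * s * bf A q q)%:P * ('X * 'X).
pose r s : {poly R} := (2 * bf B u q)%:P * 'X + (s * bf B q q)%:P * ('X * 'X)
  - 2%:P * ap s * ((bf B u w)%:P + (s * bf B q w)%:P * 'X)
  + (s * bf B w w)%:P * (ap s * ap s).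
pose af s g : R := bf A u u + 2 * s * bf A u q * g + s * s * bf A q q * (g * g).
have rE s g : (r s).[g] = 2 * bf B u q * g + s * bf B q q * (g * g)
    - 2 * af s g * (bf B u w + s * bf B q w * g) + s * bf B w w * (af s g * af s g).
  by rewrite /r /ap /af !hornerE.
have [|d [g [d0 d1 gE bg]]] := @implicit_fixpoint _ r (- bf B u u).
  under eq_fun do rewrite rE /af.
  by blip_tac.
have bs : blip (seg d) segd (fun s => s) by apply: blip_id; exact: ltW.
pose c2 s := - af s (g s).
have bc2 : blip (seg d) segd c2 by rewrite /c2 /af; blip_tac.
pose y s := x + s *: u + (s * s * g s) *: q + (s * s * c2 s) *: w.
(* [4^-1 + s * phi s] is the minor of [y s *m A], [y s *m B] on the test vectors [w], [q]; the
   radius [d'] below keeps [s * phi s] within [1 / 8], so the minor stays positive. *)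
pose phi s := 2^-1 * (bf B u q + s * (g s * bf B q q + c2 s * bf B w q))
  - (bf A u q + s * (g s * bf A q q)) * (s * (bf B u w + s * (g s * bf B q w + c2 s * bf B w w))).
have bphi : blip (seg d) segd phi by rewrite /phi; blip_tac.
have Auw : bf A u w = 0 by rewrite (bfC u w sA).
have Aqw : bf A q w = 0 by rewrite (bfC q w sA).
have Ay s : bf A (y s) (y s) = 0.
  rewrite /y !bfE (bfC u x sA) (bfC q x sA) (bfC w x sA) (bfC q u sA).
  by rewrite Ax Aww Axu Axq Axw Awq Aqw Awu Auw /c2 /af; field.
have By s : `|s| <= d -> bf B (y s) (y s) = 0.
  move=> sd; transitivity (s * s * (g s - (- bf B u u - s * (r s).[g s]))); last first.
    by rewrite -gE// subrr mulr0.
  rewrite /y !bfE (bfC u x sB) (bfC q x sB) (bfC w x sB) (bfC q u sB) (bfC w u sB) (bfC w q sB).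
  by rewrite Bx Bxu Bxq Bxw rE /c2; field.
have my s : bf A (y s) w * bf B (y s) q - bf A (y s) q * bf B (y s) w = 4^-1 + s * phi s.
  by rewrite /y !bfE Axw Auw Aqw Aww Axq Awq Bxq Bxw (bfC w q sB) /phi (bfC w q sB); field.
have [K [K0 Kb _]] := bphi.
pose d' := Num.min d (8 * (K + 1))^-1.
have d'0 : 0 < d' by rewrite lt_min d0 invr_gt0; lra.
have d'd : d' <= d by rewrite ge_min lexx.
have d'K : d' * (8 * (K + 1)) <= 1.
  rewrite -ler_pdivlMr; last by lra.
  by rewrite mul1r ge_min lexx orbT.
have Ny s : `|s| <= d' -> regular_zeros A B (y s).
  move=> sd'; have sd : `|s| <= d by exact: le_trans sd' d'd.
  split; first exact: Ay.
  split; first exact: By.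
  apply: (@indep_of_minor _ _ _ _ w q).
  rewrite -![dot _ _]/(bf _ _ _) my.
  have h : `|s * phi s| <= d' * K.
    by rewrite normrM; apply: ler_pM => //; exact: Kb.
  move: h; rewrite ler_norml => /andP[h _].
  by rewrite gt_eqF//; lra.
have y0 : y 0 = x by rewrite /y !mul0r !scale0r !addr0.
have sub t : seg d' t -> seg d t by rewrite /seg => td; exact: le_trans td d'd.
exists d', g, c2; split=> //.
- by split; [exact: (blip_weaken sub bg) | exact: (blip_weaken sub bc2)].
- split; last by rewrite /c2 /af; ring.
  by rewrite gE ?normr0 ?(ltW d0)//; ring.
move=> s sd; rewrite -/(y s).
apply: (@connected_component_max _ _ [set y s | s in `[- d', d']]).
- by exists 0 => //=; rewrite in_itv/=; lra.
- by move=> z [t]; rewrite /= in_itv/= -ler_norml => td <-; exact: Ny.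
- apply: connected_curve => //.
    by apply: (blip_weaken sub); blip_tac.
  by apply: (blip_weaken sub); blip_tac.
- by exists s => //=; rewrite in_itv/= -ler_norml.
Qed.

End LocalStructure.

(** * Components contained in a hyperplane *)

Section Hyperplane.
Set Implicit Arguments. Unset Strict Implicit. Unset Printing Implicit Defensive.
Context {R : realType} {n : nat}.
Implicit Types (M A B : 'M[R]_n) (u v w x y z q h : 'rV[R]_n) (a b s t : R).

(** A matrix of points of [S] of maximal rank has all of [S] in its row space; if that is not
    everything, its cokernel supplies [h]. *)
Lemma hyperplane_of_not_spanning (S : set 'rV[R]_n) :
  ~ (forall v, exists (k : nat) (c : 'I_k -> R) (p : 'I_k -> 'rV[R]_n),
       (forall i, S (p i)) /\ v = \sum_(i < k) c i *: p i) ->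
  exists2 h, h != 0 & forall z, S z -> dot z h = 0.
Proof.
move=> nspan.
pose P r := `[< exists k (X : 'M[R]_(k, n)), (forall i, S (row i X)) /\ \rank X = r >].
have P0 : exists r, P r.
  exists 0%N; apply/asboolP; exists 0%N, 0; split; first by case.
  by rewrite mxrank0.
have Pn r : P r -> (r <= n)%N.
  by move=> /asboolP[k [X [_ <-]]]; exact: rank_leq_col.
case: (ex_maxnP P0 Pn) => r /asboolP[k [X [SX rX]]] rmax.
have inX z : S z -> (z <= X)%MS.
  move=> Sz; have rXz : P (\rank (col_mx X z)).
    apply/asboolP; exists (k + 1)%N, (col_mx X z); split=> // i.
    case: (split_ordP i) => j ->; first by rewrite rowKu.
    by rewrite rowKd [j]ord1 row_id.
  have XXz : (X <= col_mx X z)%MS by rewrite (submx_trans (addsmxSl X z))// addsmxE.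
  have [_ XzE] := mxrank_leqif_sup XXz.
  have XzX : (col_mx X z <= X)%MS by rewrite -XzE eqn_leq mxrankS// rX rmax.
  apply: submx_trans XzX.
  by rewrite (submx_trans (addsmxSr X z))// addsmxE.
have [fullX|nfull] := boolP (row_full X).
  exfalso; apply: nspan => v.
  have /submxP[c vE] : (v <= X)%MS by exact: submx_full.
  exists k, (fun i => c ord0 i), (fun i => row i X); split=> //.
  by rewrite vE mulmx_sum_row.
have : cokermx X != 0.
  by rewrite -mxrank_eq0 mxrank_coker subn_eq0 -ltnNge ltn_neqAle rank_leq_col andbT.
rewrite -trmx_eq0 => /rowV0Pn[h /submxP[c hE] h0]; exists h => // z /inX.
rewrite submxE => /eqP zX; rewrite /dot hE trmx_mul trmxK mulmxA zX mul0mx.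
by rewrite mxE.
Qed.

Lemma cross_eq a b (p1 q1 p2 q2 : R) : (a != 0) || (b != 0) ->
  a * p1 + b * q1 = 0 -> a * p2 + b * q2 = 0 -> p1 * q2 = q1 * p2.
Proof.
move=> ab e1 e2; apply/eqP; rewrite -subr_eq0; apply/eqP.
have ea : a * (p1 * q2 - q1 * p2) = 0.
  transitivity (q2 * (0 : R) - q1 * 0); last by ring.
  by rewrite -{1}e1 -e2; ring.
have eb : b * (p1 * q2 - q1 * p2) = 0.
  transitivity (p1 * (0 : R) - p2 * 0); last by ring.
  by rewrite -{1}e2 -e1; ring.
by case/orP: ab => /mulfI; apply; rewrite mulr0.
Qed.

Lemma degenerate_of_hyperplane A B x h : A^T = A -> B^T = B ->
  (forall p r, exists z, [/\ dot z p = 0, dot z r = 0 &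
    (bf B z z != 0) || (bf A z z != 0)]) ->
  regular_zeros A B x -> h != 0 ->
  (forall z, connected_component (regular_zeros A B) x z -> dot z h = 0) ->
  exists a b, (a != 0) || (b != 0) /\
    forall z, dot z h = 0 -> bf (a *: A + b *: B) z z = 0.
Proof.
move=> sA sB codim2 Nx h0 hcomp.
have [Ax [Bx _]] := Nx.
have [w [q [[Axw Bxw Aww] [Axq Bxq Awq]]]] := regular_zero_frame sA sB Nx.
pose U u := [/\ bf A x u = 0, bf A w u = 0 & bf B x u = 0].
pose hw := dot w h; pose hq := dot q h.
(* For this element [2 * bf M x z] agrees with [dot z h] at [z = w] and [z = q]. *)
pose M := hw *: A + hq *: B.
have sM : M^T = M by rewrite /M linearD !linearZ/= sA sB.
have ME y z : bf M y z = hw * bf A y z + hq * bf B y z by rewrite /M !bfE.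
have Mxx : bf M x x = 0 by rewrite ME Ax Bx !mulr0 addr0.
have Mxw : bf M x w = hw / 2 by rewrite ME Axw Bxw mulr0 addr0.
have Mxq : bf M x q = hq / 2 by rewrite ME Axq Bxq mulr0 add0r.
have hx : dot x h = 0 by apply: hcomp; exact: connected_component_refl.
have Mxu u : U u -> bf M x u = 0 by case=> e1 e2 e3; rewrite ME e1 e3 !mulr0 addr0.
(* Write the curve as [x + s u + s^2 r(s)]. Pairing with [h] gives [dot u h = 0] and
   [dot r(s) h = 0], the latter at [s = 0] being [bf M u u = 0]. In the vanishing of [M] along the
   curve only orders three and four remain; they give the last two facts, about [- r(0)]. *)
have facts u : U u ->
    [/\ dot u h = 0, bf M u u = 0,
      bf M u (bf B u u *: q + bf A u u *: w) = 0 &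
      bf M (bf B u u *: q + bf A u u *: w) (bf B u u *: q + bf A u u *: w) = 0].
  move=> Uu; have [Axu Awu Bxu] := Uu.
  have [d [c1 [c2 [d0 [bc1 bc2] [c10 c20] yP]]]] :=
    regular_zero_curve sA sB Nx Axw Bxw Aww Axq Bxq Awq Axu Awu Bxu.
  have bs : blip (seg d) segd (fun s => s) by apply: blip_id; exact: ltW.
  have hy s : `|s| <= d -> s * (dot u h + s * (c1 s * hq + c2 s * hw)) = 0.
    move=> sd; have := hcomp _ (yP s sd); rewrite !dotDl !dotZl hx -/hw -/hq => e.
    by rewrite -[RHS]e; ring.
  have hu : dot u h = 0.
    have := @blip_zero_limit _ d (fun s => dot u h + s * (c1 s * hq + c2 s * hw)) d0.
    rewrite mul0r addr0; apply; first by blip_tac.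
    by move=> s sd s0; apply: (mulfI s0); rewrite hy// mulr0.
  have hr s : `|s| <= d -> s != 0 -> c1 s * hq + c2 s * hw = 0.
    move=> sd s0; apply: (mulfI s0); apply: (mulfI s0).
    by have := hy s sd; rewrite hu add0r mulr0 => ->; rewrite mulr0.
  have hr0 : c1 0 * hq + c2 0 * hw = 0.
    by apply: (@blip_zero_limit _ d (fun s => c1 s * hq + c2 s * hw) d0) => //; blip_tac.
  have Mu : bf M u u = 0.
    by rewrite ME -[RHS]oppr0 -hr0 c10 c20; ring.
  pose f4 s := c1 s * c1 s * bf M q q + 2 * c1 s * c2 s * bf M q w + c2 s * c2 s * bf M w w.
  pose f3 s := 2 * (c1 s * bf M u q + c2 s * bf M u w) + s * f4 s.
  have f3P s : `|s| <= d -> s != 0 -> f3 s = 0.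
    move=> sd s0.
    have [Ay [By _]] := connected_component_sub (yP s sd).
    have : bf M (x + s *: u + (s * s * c1 s) *: q + (s * s * c2 s) *: w)
                (x + s *: u + (s * s * c1 s) *: q + (s * s * c2 s) *: w) = 0.
      by rewrite ME Ay By !mulr0 addr0.
    rewrite !bfDl !bfDr !bfZl !bfZr (bfC u x sM) (bfC q x sM) (bfC w x sM).
    rewrite (bfC q u sM) (bfC w u sM) (bfC w q sM) Mxx (Mxu u Uu) Mu Mxw Mxq => e.
    apply: (mulfI s0); apply: (mulfI s0); apply: (mulfI s0); rewrite !mulr0.
    transitivity (s * (s * (s * f3 s)) + s * s * (c1 s * hq + c2 s * hw)).
      by rewrite hr// mulr0 addr0.
    by rewrite -e /f3 /f4; field.
  have f30 : f3 0 = 0.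
    apply: (@blip_zero_limit _ d f3 d0) => //.
    by rewrite /f3 /f4; blip_tac.
  have Mur : c1 0 * bf M u q + c2 0 * bf M u w = 0.
    by move: f30; rewrite /f3 mul0r addr0; lra.
  (* Order four requires the cubic term to vanish for [s != 0] too. The coefficients of [r(s)] and
     [r(0)] are orthogonal to the same nonzero pair, hence parallel, so [bf M u] kills [r(s)] once
     [r(0)] is nonzero. *)
  have f40 : f4 0 = 0.
    have [hwq|/norP[]] := boolP ((hw != 0) || (hq != 0)); last first.
      rewrite !negbK => /eqP hw0 /eqP hq0.
      by rewrite /f4 !ME hw0 hq0; ring.
    have [c0|/norP[]] := boolP ((c1 0 != 0) || (c2 0 != 0)); last first.
      rewrite !negbK => /eqP c10' /eqP c20'.
      by rewrite /f4 c10' c20'; ring.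
    apply: (@blip_zero_limit _ d f4 d0); first by rewrite /f4; blip_tac.
    move=> s sd s0.
    have Mus : c1 s * bf M u q + c2 s * bf M u w = 0.
      have cc : c2 s * c1 0 = c1 s * c2 0.
        by apply: (cross_eq hwq); [rewrite -[RHS](hr s sd s0) | rewrite -[RHS]hr0]; ring.
      have e1 : c1 0 * (c1 s * bf M u q + c2 s * bf M u w) = 0.
        transitivity (c1 s * (c1 0 * bf M u q + c2 0 * bf M u w)).
          by rewrite !mulrDr; congr (_ + _); [ring | rewrite !mulrA -cc; ring].
        by rewrite Mur mulr0.
      have e2 : c2 0 * (c1 s * bf M u q + c2 s * bf M u w) = 0.
        transitivity (c2 s * (c1 0 * bf M u q + c2 0 * bf M u w)).
          by rewrite !mulrDr; congr (_ + _); [rewrite !mulrA cc; ring | ring].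
        by rewrite Mur mulr0.
      by case/orP: c0 => /mulfI; apply; rewrite mulr0.
    by move: (f3P s sd s0); rewrite /f3 Mus mulr0 add0r => e; apply: (mulfI s0); rewrite e mulr0.
  split=> //.
    by rewrite bfDr !bfZr -[RHS]oppr0 -Mur c10 c20; ring.
  by rewrite !bfDl !bfDr !bfZl !bfZr (bfC w q sM) -[RHS]f40 /f4 c10 c20; ring.
have decomp z : exists (a b c : R) u, U u /\ z = a *: x + u + (b *: q + c *: w).
  exists (2 * bf A w z), (2 * bf B x z), (2 * bf A x z).
  exists (z - (2 * bf A w z) *: x - ((2 * bf B x z) *: q + (2 * bf A x z) *: w)).
  split; last by rewrite addrAC addrC addrCA addrC addrNK subrK.
  split.
  - by rewrite !bfE Ax Axq Axw; field.
  - by rewrite !bfE (bfC w x sA) Axw Awq Aww; field.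
  - by rewrite !bfE Bx Bxq Bxw; field.
have hwq : (hw != 0) || (hq != 0).
  apply: contraT; rewrite negb_or !negbK => /andP[/eqP hw0 /eqP hq0].
  case/eqP: h0; apply: dot_eq0.
  have [a [b [c [u [Uu hE]]]]] := decomp h; have [hu _ _ _] := facts u Uu.
  by rewrite {1}hE !dotDl !dotZl hx hu -/hw -/hq hw0 hq0; ring.
(* The second-order term is nonzero for some tangent direction; removing a multiple of [x] to land
   in [U] changes neither form. *)
have [u0 [Uu0 u00]] : exists u0, U u0 /\ (bf B u0 u0 != 0) || (bf A u0 u0 != 0).
  have [z [+ + nz]] := codim2 (x *m A) (x *m B).
  rewrite dotC (dotC z) -![dot (_ *m _) _]/(bf _ _ _) => Axz Bxz.
  exists (z - (2 * bf A w z) *: x); split; first split.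
  - by rewrite !bfE Axz Ax; ring.
  - by rewrite !bfE (bfC w x sA) Axw; field.
  - by rewrite !bfE Bxz Bx; ring.
  by rewrite !bfE (bfC z x sA) (bfC z x sB) Axz Bxz Ax Bx !(mulr0, subr0, oppr0, addr0).
exists hw, hq; split=> // z hz.
have [a [b [c [u [Uu zE]]]]] := decomp z.
have [hu Mu _ _] := facts u Uu.
have hbc : hw * c + hq * b = 0.
  by rewrite -hz zE !dotDl !dotZl hx hu -/hw -/hq; ring.
set k := b *: q + c *: w.
(* The plane of [q], [w] meets the hyperplane in a line, which contains both [k] and the
   second-order term of [v]. *)
have kprop v : U v -> bf A v v * b = bf B v v * c.
  move=> /facts[_ Mv _ _]; apply: (cross_eq hwq); last by rewrite -hbc; ring.
  by rewrite -Mv ME.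
have kfacts v : U v -> (bf B v v != 0) || (bf A v v != 0) ->
    bf M v k = 0 /\ bf M k k = 0.
  move=> Uv v0; have [_ _ Mvr Mr] := facts v Uv; have e := kprop v Uv.
  set r := bf B v v *: q + bf A v v *: w in Mvr Mr.
  have kr (t t' : R) : t != 0 -> t *: k = t' *: r -> bf M v k = 0 /\ bf M k k = 0.
    move=> t0 kE; split; apply: (mulfI t0).
      by rewrite -bfZr kE bfZr Mvr !mulr0.
    apply: (mulfI t0); rewrite -bfZr -bfZl kE bfZl bfZr Mr !mulr0 //.
  case/orP: v0 => v0.
    apply: (kr _ b v0); rewrite /k /r !scalerDr !scalerA -e.
    by rewrite (mulrC b (bf B v v)) (mulrC b (bf A v v)).
  apply: (kr _ c v0); rewrite /k /r !scalerDr !scalerA e.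
  by rewrite (mulrC c (bf B v v)) (mulrC c (bf A v v)).
have [Mu0k Mkk] := kfacts u0 Uu0 u00.
have UD (v v' : 'rV[R]_n) t : U v -> U v' -> U (v + t *: v').
  by move=> [a1 a2 a3] [b1 b2 b3]; split; rewrite !bfE ?a1 ?a2 ?a3 ?b1 ?b2 ?b3; ring.
(* If the second-order term of [u] vanishes, those of [u0 + u] and [u0 - u] sum to twice that of
   [u0], so one of them is nonzero and [kfacts] applies there. *)
have Muk : bf M u k = 0.
  have [uu|/norP[]] := boolP ((bf B u u != 0) || (bf A u u != 0)).
    by have [] := kfacts u Uu uu.
  rewrite !negbK => /eqP Bu /eqP Au.
  have key t : t != 0 -> (bf B (u0 + t *: u) (u0 + t *: u) != 0) ||
      (bf A (u0 + t *: u) (u0 + t *: u) != 0) -> bf M u k = 0.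
    move=> t0 nz; have [+ _] := kfacts _ (UD _ _ t Uu0 Uu) nz.
    by rewrite bfDl bfZl Mu0k add0r => e; apply: (mulfI t0); rewrite e mulr0.
  have [n1|] := boolP ((bf B (u0 + 1 *: u) (u0 + 1 *: u) != 0) ||
      (bf A (u0 + 1 *: u) (u0 + 1 *: u) != 0)).
    by apply: key n1; rewrite oner_eq0.
  have [n2|] := boolP ((bf B (u0 + (-1) *: u) (u0 + (-1) *: u) != 0) ||
      (bf A (u0 + (-1) *: u) (u0 + (-1) *: u) != 0)).
    by move=> _; apply: key n2; rewrite oppr_eq0 oner_eq0.
  rewrite !negb_or !negbK !bfE Bu Au => /andP[/eqP b1 /eqP a1] /andP[/eqP b2 /eqP a2].
  have : bf B u0 u0 = 0 by lra.
  have : bf A u0 u0 = 0 by lra.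
  by move=> a3 b3; move: u00; rewrite a3 b3 eqxx.
have Mxk : bf M x k = 0.
  by rewrite /k bfDr !bfZr Mxq Mxw -[RHS](mul0r 2^-1) -hbc; field.
rewrite -/k in zE; clearbody k; rewrite -/M.
rewrite zE !(bfDl, bfDr, bfZl, bfZr) (bfC u x sM) (bfC k x sM) (bfC k u sM).
by rewrite Mxx (Mxu u Uu) Mu Mxk Muk Mkk; ring.
Qed.

End Hyperplane.

(** * Pencils containing a product of two linear forms *)

Section DegeneratePencil.
Set Implicit Arguments. Unset Strict Implicit. Unset Printing Implicit Defensive.
Context {R : realType} {n : nat}.
Implicit Types (M A B C : 'M[R]_n) (u v w x y z q h l m : 'rV[R]_n) (a b c s t : R).

Definition indefinite_on_ker B l :=
  (exists2 p, dot p l = 0 & 0 < bf B p p) /\ (exists2 p, dot p l = 0 & bf B p p < 0).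

(** On the kernel of [l], [C] is both a multiple of [B] and a product of [m] with [bf B vl]. The
    given vector shows the multiple is zero, and since [m] is nonzero on this kernel, [bf B vl]
    vanishes there. *)
Lemma multiplier_of_indefinite B C l m vl vm : B^T = B -> C^T = C ->
  (forall a b, a *: l + b *: m = 0 -> a = 0 /\ b = 0) ->
  (exists z, [/\ dot z l = 0, dot z m = 0 & bf B z z != 0]) ->
  (forall z, bf C z z = 4 * (dot z l * bf B vm z + dot z m * bf B vl z)) ->
  (forall z, dot z l = 0 -> bf B z z = 0 -> bf C z z = 0) ->
  indefinite_on_ker B l ->
  exists c, forall z, bf B vl z = c * dot z l.
Proof.
move=> sB sC lm [z0 [lz0 mz0 Bz0]] CE C0 [[p lp Bp] [q lq Bq]].
have [|b bP] := @proportional_on_subspace _ _ (fun z => dot z l = 0) B C p q _ sB sC C0 lp Bp lq Bq.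
  by move=> t u v lu lv; rewrite dotDl dotZl lu lv mulr0 addr0.
have b0 : b = 0.
  apply: (mulIf Bz0); rewrite mul0r -bP// CE lz0 mz0; ring.
have mB z : dot z l = 0 -> dot z m * bf B vl z = 0.
  move=> lz; have := bP z lz; rewrite CE lz b0 !mul0r add0r => /eqP.
  by rewrite mulf_eq0 pnatr_eq0 /= => /eqP.
have [f [lf mf]] := dual_pair lm.
have [|e [me le]] := @dual_pair _ _ m l.
  by move=> a' b'; rewrite addrC => /lm[].
have Be : bf B vl e = 0.
  by have := mB e; rewrite dotC le (dotC e) me mul1r; apply.
have Bl z : dot z l = 0 -> bf B vl z = 0.
  move=> lz; have [mz|mz] := eqVneq (dot z m) 0; last first.
    by apply: (mulfI mz); rewrite mB// mulr0.
  have := mB (z + e); rewrite !dotDl lz (dotC e l) le mz (dotC e m) me addr0.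
  by rewrite add0r mul1r bfDr Be addr0; apply.
exists (bf B vl f) => z; have := Bl (z - dot z l *: f).
rewrite dotDl dotNl dotZl (dotC f l) lf mulr1 subrr => /(_ erefl).
rewrite bfDr bfNr bfZr; lra.
Qed.

(** Suppose [B] is nonnegative on the kernel of [m]. If [v] lies there, then [c] is nonzero and [B]
    is affine and nonconstant along [v] from a vector with [l = 1], so it turns negative. Otherwise
    projecting along [v] onto the kernel exhibits a semidefinite [B + t *: A]. *)
Lemma not_psd_on_ker A B l m v c : B^T = B ->
  (forall y z, bf A y z = dot y l * dot z m + dot y m * dot z l) ->
  (forall a b, a *: l + b *: m = 0 -> a = 0 /\ b = 0) ->
  (forall t, ~ (forall z, 0 <= bf (B + t *: A) z z)) ->
  dot v l = 0 -> (forall z, bf B v z = c * dot z l) ->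
  ~ (v *m A = 0 /\ v *m B = 0) ->
  exists2 z, dot z m = 0 & bf B z z < 0.
Proof.
move=> sB AE lm nd vl Bv nker; apply: contrapT => npos.
have pos z : dot z m = 0 -> 0 <= bf B z z.
  by move=> mz; rewrite leNgt; apply/negP => Bz; apply: npos; exists z.
have [mv|mv] := eqVneq (dot v m) 0.
  have [e [le me]] := dual_pair lm.
  have c0 : c = 0.
    apply/eqP; apply: contraT => cn0.
    have := pos (e + (- (bf B e e + 1) / (2 * c)) *: v).
    rewrite !dotDl !dotZl (dotC e m) me mv mulr0 addr0 => /(_ erefl).
    rewrite !bfDl !bfDr !bfZl !bfZr (bfC e v sB) !Bv vl (dotC e l) le.
    suff -> : bf B e e + - (bf B e e + 1) / (2 * c) * (c * 1) +
      (- (bf B e e + 1) / (2 * c) * (c * 1) +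
       - (bf B e e + 1) / (2 * c) * (- (bf B e e + 1) / (2 * c) * (c * 0))) = -1.
      by rewrite oppr_ge0 ler10.
    by field.
  apply: nker; split; apply: dot_ext => z; rewrite dot0r dotC.
    by rewrite -[dot _ _]/(bf A v z) AE vl mv; ring.
  by rewrite -[dot _ _]/(bf B v z) Bv c0 mul0r.
apply: (nd (- c / dot v m)) => z.
pose s := dot z m / dot v m.
have := pos (z - s *: v).
rewrite dotDl dotNl dotZl /s mulfVK// subrr => /(_ erefl).
rewrite -/s; congr (_ <= _).
rewrite !bfDl !bfDr !bfNl !bfNr !bfZl !bfZr bfDm bfZm (bfC z v sB) !Bv AE vl /s.
by field.
Qed.

Lemma indefinite_transfer A B C l m vl vm : B^T = B -> C^T = C ->
  (forall y z, bf A y z = dot y l * dot z m + dot y m * dot z l) ->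
  (forall a b, a *: l + b *: m = 0 -> a = 0 /\ b = 0) ->
  (forall t, ~ (forall z, 0 <= bf (B + t *: A) z z)) ->
  (forall t, ~ (forall z, 0 <= bf (- B + t *: A) z z)) ->
  (exists z, [/\ dot z l = 0, dot z m = 0 & bf B z z != 0]) ->
  (forall z, bf C z z = 4 * (dot z l * bf B vm z + dot z m * bf B vl z)) ->
  (forall z, bf A z z = 0 -> bf B z z = 0 -> bf C z z = 0) ->
  dot vl l = 0 -> ~ (vl *m A = 0 /\ vl *m B = 0) ->
  indefinite_on_ker B l ->
  indefinite_on_ker B m /\ exists c, forall z, bf B vl z = c * dot z l.
Proof.
move=> sB sC AE lm nd1 nd2 z0 CE C0 vll nker indl.
have [|c cP] := multiplier_of_indefinite sB sC lm z0 CE _ indl.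
  by move=> z lz; apply: C0; rewrite AE lz; ring.
split; last by exists c.
split; last exact: (not_psd_on_ker sB AE lm nd1 vll cP nker).
have sNB : (- B)^T = - B by rewrite linearN/= sB.
have [||z mz] := @not_psd_on_ker A (- B) l m vl (- c) sNB AE lm nd2 vll.
- by move=> z; rewrite bfNm cP mulNr.
- move=> [vA vB]; apply: nker; split=> //.
  by move: vB; rewrite mulmxN => /eqP; rewrite oppr_eq0 => /eqP.
- by rewrite bfNm oppr_lt0; exists z.
Qed.

(** The zeros of [A] are the two kernels. Semidefiniteness of equal sign on both contradicts the
    S-lemma; opposite signs force [B] to vanish on the intersection. *)
Lemma indefinite_on_one_ker A B l m : A^T = A -> B^T = B ->
  (forall y z, bf A y z = dot y l * dot z m + dot y m * dot z l) ->
  (forall a b, a *: l + b *: m = 0 -> a = 0 /\ b = 0) ->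
  (forall t, ~ (forall z, 0 <= bf (B + t *: A) z z)) ->
  (forall t, ~ (forall z, 0 <= bf (- B + t *: A) z z)) ->
  (exists z, [/\ dot z l = 0, dot z m = 0 & bf B z z != 0]) ->
  indefinite_on_ker B l \/ indefinite_on_ker B m.
Proof.
move=> sA sB AE lm nd1 nd2 [z0 [lz0 mz0 Bz0]].
have semi k : ~ indefinite_on_ker B k ->
    (forall z, dot z k = 0 -> bf B z z <= 0) \/ (forall z, dot z k = 0 -> 0 <= bf B z z).
  move=> nind; have [pos|npos] := pselect (exists2 p, dot p k = 0 & 0 < bf B p p).
    right=> z kz; rewrite leNgt; apply/negP => Bz; apply: nind; split=> //.
    by exists z.
  by left=> z kz; rewrite leNgt; apply/negP => Bz; apply: npos; exists z.
have [f [lf mf]] := dual_pair lm.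
have [|e [me le]] := @dual_pair _ _ m l.
  by move=> a' b'; rewrite addrC => /lm[].
have Ap : 0 < bf A (e + f) (e + f).
  by rewrite AE !dotDl !(dotC e) !(dotC f) lf mf me le; lra.
have Am : bf A (e - f) (e - f) < 0.
  by rewrite AE !dotDl !dotNl !(dotC e) !(dotC f) lf mf me le; lra.
have A0 z : bf A z z = 0 -> dot z l = 0 \/ dot z m = 0.
  rewrite AE => Az; have /eqP : dot z l * dot z m = 0 by lra.
  by rewrite mulf_eq0 => /orP[] /eqP; [left | right].
apply: contrapT => /not_orP[/semi sl /semi sm].
case: sl => sl; case: sm => sm.
- have sNB : (- B)^T = - B by rewrite linearN/= sB.
  have [|t] := S_lemma sA sNB Ap Am; last exact: nd2.
  by move=> z /A0[lz|mz]; rewrite bfNm oppr_ge0; [exact: sl | exact: sm].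
- by case/eqP: Bz0; apply/eqP; rewrite eq_le sl// sm.
- by case/eqP: Bz0; apply/eqP; rewrite eq_le sl// sm.
- have [|t] := S_lemma sA sB Ap Am; last exact: nd1.
  by move=> z /A0[lz|mz]; [exact: sl | exact: sm].
Qed.

(** For [e] with [dot e h = 1], expanding the vanishing of [M] at the projections [y - dot y h *: e]
    determines [m]. *)
Lemma split_of_hyperplane M h : M^T = M -> h != 0 ->
  (forall z, dot z h = 0 -> bf M z z = 0) ->
  exists m, forall y z, bf M y z = dot y h * dot z m + dot y m * dot z h.
Proof.
move=> sM h0 Mh.
have hh : dot h h != 0 by apply: contra_neq h0; exact: dot_eq0.
pose e := (dot h h)^-1 *: h.
have eh : dot e h = 1 by rewrite /e dotZl mulVf.
clearbody e.
exists (e *m M - (bf M e e / 2) *: h) => y z.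
have := Mh (y - dot y h *: e); have := Mh (z - dot z h *: e).
have := Mh (y + z - (dot y h + dot z h) *: e).
rewrite !(dotDl, dotNl, dotZl) eh !mulr1 !subrr => /(_ erefl) e1 /(_ erefl) e2 /(_ erefl) e3.
rewrite !dotDr !dotNr !dotZr (dotC z (e *m M)) (dotC y (e *m M)).
rewrite -![dot (e *m M) _]/(bf M e _).
move: e1 e2 e3; rewrite !(bfDl, bfDr, bfNl, bfNr, bfZl, bfZr).
rewrite (bfC z y sM) (bfC y e sM) (bfC z e sM); nra.
Qed.

End DegeneratePencil.

(** * Hamiltonian vectors and Poisson brackets of quadratic forms *)

Section Symplectic.
Set Implicit Arguments. Unset Strict Implicit. Unset Printing Implicit Defensive.
Context {R : realType} {d : nat}.
Implicit Types (M A B C : 'M[R]_(d + d)) (u v w x y z l m : 'rV[R]_(d + d)).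

(** The Hamiltonian vector of the linear form [dot u]: differentiating along it is taking the
    bracket with that form. *)
Definition Jrow u : 'rV[R]_(d + d) := row_mx (rsubmx u) (- lsubmx u).

Lemma symplE u w : sympl u w = dot (Jrow u) w.
Proof.
rewrite dotE big_split_ord /= -big_split /sympl; apply: eq_bigr => j _ /=.
by rewrite row_mxEl row_mxEr !mxE mulNr.
Qed.

Lemma sympl_Jrow u w : sympl (Jrow u) w = - dot u w.
Proof.
rewrite dotE big_split_ord /= -big_split /sympl -sumrN; apply: eq_bigr => j _ /=.
by rewrite row_mxEl row_mxEr !mxE; ring.
Qed.

Lemma sympl_self u : sympl u u = 0.
Proof. by rewrite /sympl big1// => j _; rewrite mulrC subrr. Qed.

Lemma sympl_antisym u w : sympl u w = - sympl w u.
Proof. by rewrite /sympl -sumrN; apply: eq_bigr => j _; ring. Qed.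

Lemma symplDl u v w : sympl (u + v) w = sympl u w + sympl v w.
Proof. by rewrite !(sympl_antisym _ w) !symplE dotDr opprD. Qed.

Lemma symplZl (a : R) u w : sympl (a *: u) w = a * sympl u w.
Proof. by rewrite !(sympl_antisym _ w) !symplE dotZr mulrN. Qed.

Lemma symplDr u v w : sympl w (u + v) = sympl w u + sympl w v.
Proof. by rewrite !symplE dotDr. Qed.

Lemma symplZr (a : R) u w : sympl w (a *: u) = a * sympl w u.
Proof. by rewrite !symplE dotZr. Qed.

Lemma Jrow_eq0 u : Jrow u = 0 -> u = 0.
Proof.
move=> Ju; apply: dot_eq0; apply: oppr_inj; rewrite -sympl_Jrow Ju oppr0.
by rewrite /sympl big1// => j _; rewrite !mxE !mul0r subrr.
Qed.

Lemma QfE M z : Qf M z = bf M z z.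
Proof. by []. Qed.

Lemma derive_Qf M z v : M^T = M -> 'D_v (Qf M) z = 2 * bf M z v.
Proof.
move=> sM; rewrite /derive; apply: cvg_lim => //.
have lim0 : (fun h : R => 2 * bf M z v + h * bf M v v) @ 0^' --> 2 * bf M z v.
  rewrite -[X in _ --> X]addr0 -[X in _ + X](mul0r (bf M v v)).
  apply: cvgD; first exact: cvg_cst.
  apply: cvgMr_tmp; exact: cvg_within.
apply: cvg_trans lim0; apply: near_eq_cvg; near=> h.
have h0 : h != 0 by near: h; exact: nbhs_dnbhs_neq.
rewrite /= /shift/= !QfE !bfE (bfC v z sM).
rewrite /GRing.scale/=; field.
exact: h0.
Unshelve. all: by end_near.
Qed.

Lemma poisson_Qf A B z : A^T = A -> B^T = B ->
  poisson (Qf A) (Qf B) z = 4 * sympl (z *m A) (z *m B).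
Proof.
move=> sA sB; rewrite /poisson /sympl mulr_sumr; apply: eq_bigr => j _.
have pdE M i : M^T = M -> pd (Qf M) i z = 2 * (z *m M) ord0 i.
  move=> sM; rewrite /pd derive_Qf// /bf dotE /ebasis (bigD1 i)//= big1 ?addr0.
    by rewrite [delta_mx _ _ _ _]mxE !eqxx mulr1.
  by move=> k /negPf ki; rewrite [delta_mx _ _ _ _]mxE ki andbF mulr0.
by rewrite !pdE//; ring.
Qed.

End Symplectic.

(** * Change of basis in the pencil and the two eigenvector relations *)

Theorem theorem3p5 (R : realType) (d : nat) (A B C : 'M[R]_(d + d)) :
  symmetric_mx A -> symmetric_mx B -> symmetric_mx C ->
  lin_indep2 A B ->
  non_dissipative A B ->
  maxrank_ge A B 7 ->
  (forall z, Qf C z = poisson (Qf A) (Qf B) z) ->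
  (forall z, Qf A z = 0 -> Qf B z = 0 -> Qf C z = 0) ->
  (is_zero_subspace (common_ker A B) \/ symplectic_subspace (common_ker A B)) ->
  (forall x, Nset A B x -> ~ spans_all (connected_component (Nset A B) x)) ->
  exists a b : R, C = a *: A + b *: B.
Proof.
move=> sA sB sC indAB nd [ra [rb rk]] CE C0 kerAB nspan.
(* Inside [\rank] the [+] of [maxrank_ge] is the sum of row spaces, so [rk] only
   bounds the codimension of the common kernel, not the rank of an element. *)
have codim2 (p r : 'rV[R]_(d + d)) : exists z, [/\ dot z p = 0, dot z r = 0 &
    (bf B z z != 0) || (bf A z z != 0)].
  apply: contrapT => nz; move: rk; rewrite ltnNge => /negP; apply.
  (* Two linear forms give the bound [3 * 2 = 6], just below [7]. *)
  apply: (@rank_isotropic_pair _ _ (1 + 1) (row_mx p^T r^T)).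
  - by rewrite linearZ/= sA.
  - by rewrite linearZ/= sB.
  move=> z; rewrite mul_mx_row => zK.
  have [e1 e2] : z *m p^T = 0 /\ z *m r^T = 0.
    by apply: eq_row_mx; rewrite zK row_mx0.
  have [Bz|Bz] := eqVneq (bf B z z) 0; last first.
    by case: nz; exists z; rewrite Bz; split=> //; rewrite /dot ?e1 ?e2 mxE.
  have [Az|Az] := eqVneq (bf A z z) 0; last first.
    by case: nz; exists z; rewrite Az orbT; split=> //; rewrite /dot ?e1 ?e2 mxE.
  by rewrite !bfZm Az Bz !mulr0.
(* Either [A] vanishes on a hyperplane, or there is a regular zero whose component lies in one. *)
have [a [b [h [ab h0 Mh]]]] : exists a b (h : 'rV[R]_(d + d)),
    [/\ (a != 0) || (b != 0), h != 0 &
      forall z, dot z h = 0 -> bf (a *: A + b *: B) z z = 0].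
  have [[x [Ax Bx indx]]|[h h0 hA]] := regular_zero sA sB indAB nd; last first.
    exists 1, 0, h; split; rewrite ?oner_eq0// => z /hA Az.
    by rewrite !bfE Az; ring.
  have Nx : regular_zeros A B x by [].
  have [h h0 hS] := hyperplane_of_not_spanning (nspan x Nx).
  have [a [b [ab abP]]] := degenerate_of_hyperplane sA sB codim2 Nx h0 hS.
  by exists a, b, h.
(* Turning [(a, b)] by a right angle completes [M] to a basis of the pencil with determinant [k],
   whichever of [a], [b] is nonzero. *)
pose M := a *: A + b *: B; pose B' := (- b) *: A + a *: B.
pose k := a ^+ 2 + b ^+ 2.
have k0 : k != 0.
  by rewrite paddr_eq0 ?sqr_ge0// !sqrf_eq0 negb_and.
have sM : M^T = M by rewrite /M linearD !linearZ/= sA sB.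
have sB' : B'^T = B' by rewrite /B' linearD !linearZ/= sA sB.
have kA y z : k * bf A y z = a * bf M y z - b * bf B' y z by rewrite /M /B' !bfE /k; ring.
have kB y z : k * bf B y z = b * bf M y z + a * bf B' y z by rewrite /M /B' !bfE /k; ring.
have [m ME] := split_of_hyperplane sM h0 Mh.
have psd_M (s t : R) : (forall z, 0 <= bf (s *: M + t *: B') z z) -> s = 0 /\ t = 0.
  move=> pos.
  have : (s * a - t * b) *: A + (s * b + t * a) *: B = 0.
    apply: nd => z; rewrite QfE; have := pos z.
    by rewrite /M /B' !bfE; congr (_ <= _); ring.
  move=> /indAB[e1 e2]; split; apply: (mulIf k0); rewrite mul0r.
    transitivity (a * (0 : R) + b * 0); last by ring.
    by rewrite -{1}e1 -e2 /k; ring.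
  transitivity (- b * (0 : R) + a * 0); last by ring.
  by rewrite -{1}e1 -e2 /k; ring.
(* If [m] were a multiple of [h], the form of [M] would be a multiple of a square, hence
   semidefinite up to sign. *)
have lm s t : s *: h + t *: m = 0 -> s = 0 /\ t = 0.
  move=> st; have stz z : s * dot z h + t * dot z m = 0.
    by rewrite -!dotZr -dotDr st dot0r.
  have t0 : t = 0.
    apply/eqP; apply: contraT => t0.
    have Mss z : - s * t * bf M z z = 2 * (s * dot z h) ^+ 2.
      rewrite ME; have := stz z => /eqP; rewrite addr_eq0 => /eqP e.
      transitivity (- 2 * (s * dot z h) * (t * dot z m)); first by ring.
      by rewrite e; ring.
    have [|/eqP] := psd_M (- s * t) 0.
      by move=> z; rewrite scale0r addr0 bfZm Mss mulr_ge0// sqr_ge0.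
    rewrite mulf_eq0 oppr_eq0 (negPf t0) orbF => /eqP s0 _.
    have m0 z : dot z m = 0 by apply: (mulfI t0); have := stz z; rewrite s0 mul0r add0r mulr0.
    have [|/eqP] := psd_M 1 0; last by rewrite oner_eq0.
    by move=> z; rewrite scale0r addr0 scale1r ME !m0; rewrite mulr0 mul0r addr0.
  split=> //; move: st; rewrite t0 scale0r addr0 => /eqP.
  by rewrite scaler_eq0 (negPf h0) orbF => /eqP.
have nd1 t : ~ (forall z, 0 <= bf (B' + t *: M) z z).
  move=> pos; have [] := psd_M t 1; last by move=> _ /eqP; rewrite oner_eq0.
  by move=> z; rewrite scale1r addrC.
have nd2 t : ~ (forall z, 0 <= bf (- B' + t *: M) z z).
  move=> pos; have [] := psd_M t (-1); last by move=> _ /eqP; rewrite oppr_eq0 oner_eq0.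
  by move=> z; rewrite scaleN1r addrC.
have zeros z : bf M z z = 0 -> bf B' z z = 0 -> bf A z z = 0 /\ bf B z z = 0.
  by move=> Mz Bz; split; apply: (mulfI k0); rewrite ?kA ?kB Mz Bz; ring.
have [z0 [hz0 mz0 Bz0]] : exists z, [/\ dot z h = 0, dot z m = 0 & bf B' z z != 0].
  have [z [hz mz nz]] := codim2 h m; exists z; split=> //.
  apply/eqP => Bz; have [|Az Bz'] := zeros z _ Bz; first by rewrite ME hz; ring.
  by move: nz; rewrite Az Bz' eqxx.
have sJ (l z : 'rV[R]_(d + d)) : sympl l (z *m B') = bf B' (Jrow l) z.
  by rewrite symplE (bfC _ _ sB') dotC.
(* The alternating bracket is multiplied by the determinant [k] under the change of basis; then the
   Leibniz rule is applied to the product form of [M]. *)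
have kC z : bf (k *: C) z z =
    4 * (dot z h * bf B' (Jrow m) z + dot z m * bf B' (Jrow h) z).
  rewrite bfZm -QfE CE poisson_Qf// -!sJ.
  have zM : z *m M = dot z h *: m + dot z m *: h.
    apply: dot_ext => w; rewrite dotC -[dot _ _]/(bf M z w) ME dotDr !dotZr.
    by ring.
  have lin : sympl (z *m M) (z *m B') = dot z h * sympl m (z *m B') + dot z m * sympl h (z *m B').
    by rewrite zM symplDl !symplZl.
  have bil : sympl (z *m M) (z *m B') = k * sympl (z *m A) (z *m B).
    rewrite /M /B' !mulmxDr -!scalemxAr !(symplDl, symplDr, symplZl, symplZr).
    by rewrite !sympl_self (sympl_antisym (z *m B) (z *m A)) /k; ring.
  by rewrite -lin bil; ring.
have C'0 z : bf M z z = 0 -> bf B' z z = 0 -> bf (k *: C) z z = 0.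
  by move=> Mz Bz; rewrite bfZm -QfE C0 ?mulr0//; have [] := zeros z Mz Bz.
have skC : (k *: C)^T = k *: C by rewrite linearZ/= sC.
(* If [Jrow l] were in the common kernel, its symplectic product with any [w] there would be
   [- dot l w = 0], and the hypothesis on that kernel would give [Jrow l = 0]. *)
have nker l : l != 0 -> (forall w, w *m M = 0 -> dot w l = 0) ->
    ~ (Jrow l *m M = 0 /\ Jrow l *m B' = 0).
  move=> l0 kl [JM JB].
  have Jk : common_ker A B (Jrow l).
    split; apply: dot_ext => z; apply: (mulfI k0); rewrite dot0r mulr0 dotC.
      by rewrite -[dot _ _]/(bf A _ z) kA /bf JM JB dot0l; ring.
    by rewrite -[dot _ _]/(bf B _ z) kB /bf JM JB dot0l; ring.
  case/eqP: l0; apply: Jrow_eq0.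
  case: kerAB => [ker0|[_ [_ nondeg]]]; first by move: Jk; rewrite ker0.
  apply: nondeg => // w [wA wB]; rewrite sympl_Jrow dotC kl ?oppr0//.
  by rewrite /M mulmxDr -!scalemxAr wA wB !scaler0 addr0.
have kerM w : w *m M = 0 -> dot w h = 0 /\ dot w m = 0.
  move=> wM; have [] := lm (dot w m) (dot w h); last by [].
  apply: dot_ext => z; rewrite dotDr !dotZr dot0r.
  have : bf M w z = 0 by rewrite /bf wM dot0l.
  by rewrite ME => <-; ring.
have m0 : m != 0.
  apply/eqP => m0; have [] := lm 0 1; last by move=> _ /eqP; rewrite oner_eq0.
  by rewrite m0 scaler0 scale0r addr0.
have nkh := nker h h0 (fun w wM => (kerM w wM).1).
have nkm := nker m m0 (fun w wM => (kerM w wM).2).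
have Jself (l : 'rV[R]_(d + d)) : dot (Jrow l) l = 0 by rewrite -symplE sympl_self.
have ME' y z : bf M y z = dot y m * dot z h + dot y h * dot z m by rewrite ME addrC.
have ml s t : s *: m + t *: h = 0 -> s = 0 /\ t = 0.
  by rewrite addrC => /lm[].
have kC' z : bf (k *: C) z z =
    4 * (dot z m * bf B' (Jrow h) z + dot z h * bf B' (Jrow m) z).
  by rewrite kC addrC.
have th := indefinite_transfer sB' skC ME lm nd1 nd2
  (ex_intro _ z0 (And3 hz0 mz0 Bz0)) kC C'0 (Jself h) nkh.
have tm := indefinite_transfer sB' skC ME' ml nd1 nd2
  (ex_intro _ z0 (And3 mz0 hz0 Bz0)) kC' C'0 (Jself m) nkm.
(* Indefiniteness on either kernel transfers to the other, the roles of [h] and [m] being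
   symmetric. *)
have [ih im] : indefinite_on_ker B' h /\ indefinite_on_ker B' m.
  have [i|i] := indefinite_on_one_ker sM sB' ME lm nd1 nd2
    (ex_intro _ z0 (And3 hz0 mz0 Bz0)).
    by have [] := th i.
  by have [] := tm i.
have [_ [c1 c1P]] := th ih; have [_ [c2 c2P]] := tm im.
have CM : k *: C = (2 * (c1 + c2)) *: M.
  apply: bf_ext_sym => // [|z]; first by rewrite linearZ/= sM.
  by rewrite kC bfZm ME c1P c2P; ring.
exists (k^-1 * (2 * (c1 + c2)) * a), (k^-1 * (2 * (c1 + c2)) * b).
have -> : C = k^-1 *: (k *: C) by rewrite scalerA mulVf// scale1r.
by rewrite CM /M !scalerDr !scalerA !mulrA.
Qed.
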